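(* Let $\ell \ge 2$ and let $\mathcal{R}$ be a merging $\ell$-vertex rule for which there exist functions $d_k:\mathbb{N}^\ell\to\mathbb{R}$ ($k\ge1$) such that, whenever $v_1,\dots,v_\ell$ all lie in different components of $G_{n,m}$, $\mathbb{E}(N_{n,k,m+1}-N_{n,k,m}\mid\mathcal{F}_{n,m},\mathbf{v}_{n,m+1})=d_k(c_1,\dots,c_\ell)$. Assume that for some $t^*\in[0,\infty)$ every solution $(\tilde\rho_k(t))_{k\ge1}$ on $[0,t^*]$ of the system (i) $0\le\rho_k(t)\le1$ and $0\le\sum_{k\ge1}\rho_k(t)\le1$; (ii') $\rho_k'(t)=\sum_{c_1,\dots,c_\ell\in\mathbb{N}}d_k(c_1,\dots,c_\ell)\prod_{j\in[\ell]}\rho_{c_j}(t)$ for all $k\ge1$ (right derivative at $t=0$); (iv) $\rho_1(0)=1$ and $\rho_k(0)=0$ for $k\ge2$, satisfies $\sum_{k\ge1}\tilde\rho_k(t^* )<1$. Then for any $t^*\le t<\infty$ and $\varepsilon>0$ there exist $\alpha,n_0>0$ such that $\Pr\bigl(L_1(G_{n,\lfloor tn\rfloor})\ge\alpha n\bigr)\ge1-\varepsilon$ for all $n\ge n_0$.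
   Context: Fix $\ell\ge 2$. An $\ell$-vertex rule $\mathcal{R}$ yields, for each $n$, a random sequence of graphs $(G_{n,m})_{m\ge 0}$ on $[n]$, defined on a probability space with a filtration $\mathcal{F}_{n,0}\subseteq\mathcal{F}_{n,1}\subseteq\cdots$: $G_{n,0}$ is empty; for each $m\ge0$ a tuple $\mathbf{v}_{n,m+1}=(v_1,\dots,v_\ell)$ is drawn from $[n]$ independently and uniformly at random, $\mathcal{F}_{n,m+1}$-measurable and independent of $\mathcal{F}_{n,m}$; and $G_{n,m+1}=G_{n,m}\cup E_{n,m+1}$ with $E_{n,m+1}$ an $\mathcal{F}_{n,m+1}$-measurable set of pairs among $v_1,\dots,v_\ell$, nonempty whenever the $v_j$ lie in $\ell$ distinct components of $G_{n,m}$. $c_j$ is the size of the component of $G_{n,m}$ containing $v_j$; $N_{n,k,m}$ is the number of vertices of $G_{n,m}$ in components of size exactly $k$; $L_1(G)$ is the number of vertices in a largest component of $G$. Merging: whenever $C,C'$ are distinct components of $G_{n,m}$ with $|C|,|C'|\ge\varepsilon n$, conditional on $\mathcal{F}_{n,m}$ they are joined in $G_{n,m+1}$ with probability at least $\varepsilon^\ell$. *)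

(* Defs.v *)
From HB Require Import structures.
From mathcomp Require Import all_boot all_order all_algebra.
From mathcomp Require Import all_classical all_reals all_analysis.
Set Implicit Arguments. Unset Strict Implicit. Unset Printing Implicit Defensive.
Import Order.TTheory GRing.Theory Num.Theory.
Import numFieldNormedType.Exports.
Local Open Scope classical_set_scope.
Local Open Scope ring_scope.

(* One step of the process on vertex set [n] = 'I_n with an l-vertex rule:
   the drawn tuple v = (v_1,...,v_l) and the set E of added pairs, given by
   pairs of positions (i,j) meaning the pair {v_i, v_j}. *)
Definition step (n l : nat) := ({ffun 'I_l -> 'I_n} * {set ('I_l * 'I_l)})%type.

(* An l-vertex rule, given by its (conditional) law: for each n, each past
   history (sequence of steps) and each new tuple v, the probability
   [r n h v E] that the edge set E is added. *)
Definition rule (R : realType) (l : nat) :=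
  forall n : nat, seq (step n l) -> {ffun 'I_l -> 'I_n} -> {set ('I_l * 'I_l)} -> R.

Definition hadj (n l : nat) (h : seq (step n l)) : rel 'I_n := fun x y =>
  has (fun s : step n l =>
         [exists p in s.2, ((s.1 p.1 == x) && (s.1 p.2 == y))
                        || ((s.1 p.1 == y) && (s.1 p.2 == x))]) h.

Definition comp (n l : nat) (h : seq (step n l)) (x : 'I_n) : {set 'I_n} :=
  [set y | connect (hadj h) x y].

Definition Ncount (n l : nat) (h : seq (step n l)) (k : nat) : nat :=
  #|[set x | #|comp h x| == k]|.

Definition L1 (n l : nat) (h : seq (step n l)) : nat :=
  \max_(x : 'I_n) #|comp h x|.

Definition distinct_comps (n l : nat) (h : seq (step n l)) (v : {ffun 'I_l -> 'I_n}) :=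
  forall i j : 'I_l, i != j -> ~~ connect (hadj h) (v i) (v j).

Definition nonempty_pairs (l : nat) (E : {set ('I_l * 'I_l)}) : bool :=
  [exists p in E, p.1 != p.2].

(* probability weight of a history: tuples uniform on [n]^l, edge sets by r *)
Fixpoint hw (R : realType) (l : nat) (r : rule R l) (n : nat)
    (pre rest : seq (step n l)) : R :=
  match rest with
  | [::] => 1
  | s :: rest' => (n%:R ^- l) * r n pre s.1 s.2 * hw r (rcons pre s) rest'
  end.

Definition weight (R : realType) (l : nat) (r : rule R l) (n : nat)
    (h : seq (step n l)) : R := hw r [::] h.

Definition prob (R : realType) (l : nat) (r : rule R l) (n m : nat)
    (P : pred (seq (step n l))) : R :=
  \sum_(h : m.-tuple (step n l) | P h) weight r h.

Definition valid_rule (R : realType) (l : nat) (r : rule R l) :=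
  forall n (h : seq (step n l)) (v : {ffun 'I_l -> 'I_n}),
    [/\ (forall E, 0 <= r n h v E),
        \sum_(E : {set ('I_l * 'I_l)}) r n h v E = 1 &
        (distinct_comps h v -> forall E, 0 < r n h v E -> nonempty_pairs E)].

Definition merging (R : realType) (l : nat) (r : rule R l) :=
  forall (eps : R), 0 < eps ->
  forall n (h : seq (step n l)), 0 < weight r h ->
  forall x y : 'I_n, ~~ connect (hadj h) x y ->
    eps * n%:R <= #|comp h x|%:R -> eps * n%:R <= #|comp h y|%:R ->
    eps ^+ l <= \sum_(v : {ffun 'I_l -> 'I_n}) \sum_(E : {set ('I_l * 'I_l)})
                  (n%:R ^- l) * r n h v E
                  * (connect (hadj (rcons h (v, E))) x y)%:R.

(* E(N_{n,k,m+1} - N_{n,k,m} | F_{n,m}, v_{n,m+1}) = d_k(c_1,...,c_l)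
   whenever the v_j lie in distinct components (a.s.: on histories of
   positive probability). *)
Definition drift (R : realType) (l : nat) (r : rule R l)
    (d : nat -> ('I_l -> nat) -> R) :=
  forall n (h : seq (step n l)), 0 < weight r h ->
  forall v : {ffun 'I_l -> 'I_n}, distinct_comps h v ->
  forall k, (0 < k)%N ->
    \sum_(E : {set ('I_l * 'I_l)})
       r n h v E * ((Ncount (rcons h (v, E)) k)%:R - (Ncount h k)%:R)
    = d k (fun j => #|comp h (v j)|).

(* partial sums of a family indexed by N^l = {1,2,...}^l over the boxes [1,N]^l *)
Definition box_sum (R : realType) (l : nat) (F : ('I_l -> nat) -> R) (N : nat) : R :=
  \sum_(c : {ffun 'I_l -> 'I_N}) F (fun j => (c j).+1).

Definition summable_to (R : realType) (l : nat) (F : ('I_l -> nat) -> R) (s : R) :=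
  (exists B : R, forall N, box_sum (fun c => `|F c|) N <= B) /\
  (box_sum F N @[N --> \oo] --> s).

(* (rho_k)_{k>=1} solves (i), (ii'), (iv) on [0, ts]; derivatives are taken
   within [0, ts] (one-sided at the endpoints). *)
Definition is_solution (R : realType) (l : nat) (d : nat -> ('I_l -> nat) -> R)
    (ts : R) (rho : nat -> R -> R) :=
  [/\ (forall t, 0 <= t <= ts -> forall k, (0 < k)%N -> 0 <= rho k t <= 1),
      (forall t, 0 <= t <= ts -> forall N, 0 <= \sum_(1 <= k < N) rho k t <= 1),
      (forall k, (0 < k)%N -> forall t, 0 <= t <= ts ->
         exists2 s, summable_to (fun c => d k c * \prod_(j < l) rho (c j) t) s &
           (fun u => (rho k u - rho k t) / (u - t))
             @ within [set u | 0 <= u <= ts /\ u != t] (nbhs t) --> s),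
      rho 1%N 0 = 1 &
      (forall k, (1 < k)%N -> rho k 0 = 0)].
Arguments prob {R l} r n m P.

(* Main.v *)
Require Import Defs.
From HB Require Import structures.
From mathcomp Require Import all_boot all_order all_algebra.
From mathcomp Require Import all_classical all_reals all_analysis.
From mathcomp Require Import ring lra.
Import Order.TTheory GRing.Theory Num.Theory.
Import numFieldNormedType.Exports.
Set Implicit Arguments. Unset Strict Implicit. Unset Printing Implicit Defensive.
Local Open Scope classical_set_scope.
Local Open Scope ring_scope.

(* If the conclusion fails, then for a sequence of n's tending to infinity there are
   histories with L1 = o(n) along which all the martingale parts of the counts N_k are
   o(n) (fourth moment bound). An ultralimit of the rescaled counts N_k(tn)/n gives
   Lipschitz functions rho_k. The differential equations hold for rho as long as no mass
   is lost, since then two of the drawn vertices share a component with probability o(1)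
   and components of unbounded size are rarely hit.
   That sum_k rho_k(ts) = 1 is the argument showing that "explosive percolation" is
   continuous. If mass delta sat in components of unbounded size at time ts, then for each
   k at least delta/2 would be in components of size >= k from time ts - c/k on. During
   this time the number of components of size about k has to drop by const * n/k; hence
   constant mass lies in components of size in [k/m, km] at time ts - c/k, and a constant
   fraction of these is never touched up to time ts. Summed over disjoint windows, this
   contradicts sum_k rho_k(ts) <= 1. *)

(** Truncating the infinite sum in (ii') at size B costs a multiple of the mass in components larger
    than B. Mass below a fixed size never increases in time, so conservation at the single time [ts]
    makes these tails uniformly small on [0, [ts]]. The limit is then a solution of total mass 1,
    against the assumption.

    Counting components near a given size is awkward in one step, hence [potential]. It never
    increases, changes by at most [l], and loses at least 1 when [l] distinct components of size at
    least k are drawn, because the rule must then join two of them.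

    Fourth moments replace a maximal inequality. For a martingale with bounded increments, fourth
    powers summed over O(n) times have mean O(n^3), negligible against n^4, so one Markov inequality
    controls all times; squares would give n^2 against n^2.

    Along an ultrafilter every bounded sequence converges, so limits exist for all real times and
    all sizes at once. *)

Local Notation cc := Defs.comp.

(** * Components and vertex counts under one step *)

Section Components.
Variables (n l : nat).
Implicit Types (h : seq (step n l)) (s : step n l) (x y : 'I_n).

Lemma hadj_sym h : symmetric (hadj h).
Proof.
move=> x y; apply: eq_has => s; apply: eq_existsb => p.
by rewrite orbC.
Qed.

Lemma hconnect_sym h : connect_sym (hadj h).
Proof. exact: sym_connect_sym (@hadj_sym h). Qed.

Lemma comp_refl h x : x \in cc h x.
Proof. by rewrite inE connect0. Qed.

Lemma card_comp_gt0 h x : (0 < #|cc h x|)%N.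
Proof. by apply/card_gt0P; exists x; exact: comp_refl. Qed.

Lemma comp_sym h x y : (y \in cc h x) = (x \in cc h y).
Proof. by rewrite !inE hconnect_sym. Qed.

Lemma comp_eq h x y : y \in cc h x -> cc h y = cc h x.
Proof.
rewrite inE => xy; apply/finset.setP => z; rewrite !inE.
by rewrite (same_connect (hconnect_sym h) xy).
Qed.

Lemma comp_cat h1 h2 x : cc h1 x \subset cc (h1 ++ h2) x.
Proof.
apply/fintype.subsetP => y; rewrite !inE; apply: connect_sub => {y}x y xy.
by apply: connect1; rewrite /hadj has_cat -/(hadj h1 x y) xy.
Qed.

Lemma comp_rcons h s x : cc h x \subset cc (rcons h s) x.
Proof. by rewrite -cats1; exact: comp_cat. Qed.

Lemma comp_untouched h s x :
  (forall j, s.1 j \notin cc h x) -> cc (rcons h s) x = cc h x.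
Proof.
move=> untouched; apply/eqP; rewrite finset.eqEsubset comp_rcons andbT.
(* An added pair has both ends among the drawn vertices, so no new adjacency leaves the old
   component. *)
have clos : closed_mem (hadj (rcons h s)) (mem (cc h x)).
  apply: (intro_closed (hconnect_sym _)) => y z yz yx.
  move: yz; rewrite /hadj has_rcons => /orP[|yz].
    move=> /existsP[p /andP[_ /orP[]/andP[/eqP e1 /eqP e2]]].
      by move: (untouched p.1); rewrite e1 yx.
    by move: (untouched p.2); rewrite e2 yx.
  by move: yx; rewrite !inE => /connect_trans; apply; exact: connect1.
apply/fintype.subsetP => y; rewrite inE => xy.
by rewrite -(closed_connect clos xy) comp_refl.
Qed.

Lemma comp_changed h s x :
  cc (rcons h s) x != cc h x -> exists j, x \in cc h (s.1 j).
Proof.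
move=> ne; have [//|E] := pselect (exists j, x \in cc h (s.1 j)).
case/eqP: ne; apply: comp_untouched => j; rewrite comp_sym; apply/negP => xj.
by apply: E; exists j.
Qed.

Lemma comp_empty x : cc (nil : seq (step n l)) x = [set x]%SET.
Proof.
apply/finset.setP => y; rewrite !inE; apply/idP/eqP => [|->]; last exact: connect0.
by move=> /connectP[[|z p] //= /andP[]].
Qed.


Definition Nlt h (k : nat) : nat := \sum_(x : 'I_n) (#|cc h x| < k).

Lemma NcountE h k : Ncount h k = (\sum_(x : 'I_n) (#|cc h x| == k))%N.
Proof.
rewrite /Ncount -sum1_card big_mkcond /=; apply: eq_bigr => x _.
have -> : (x \in mkset (fun x => #|cc h x| == k)) = (#|cc h x| == k).
  by apply/idP/idP; rewrite inE.
by case: eqP.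
Qed.

Lemma sum_Ncount h k : (\sum_(1 <= j < k) Ncount h j)%N = Nlt h k.
Proof.
under eq_bigr do rewrite NcountE.
rewrite exchange_big /=; apply: eq_bigr => x _.
have := card_comp_gt0 h x; move: #|_| => c c0.
case: ltnP => ck.
  rewrite (bigD1_seq c) ?mem_index_iota ?c0 ?iota_uniq //= eqxx big1 // => i.
  by rewrite eq_sym => /negbTE ->.
rewrite big_nat big1 // => i /andP[_ ik].
by rewrite gtn_eqF //; exact: leq_trans ik ck.
Qed.

Lemma sum_mem_comp h y : (\sum_(x : 'I_n) (x \in cc h y))%N = #|cc h y|.
Proof. by rewrite -sum1_card [RHS]big_mkcond; apply: eq_bigr => x _; case: ifP. Qed.

(** Only vertices in the component of a drawn vertex can change component, so each drawn vertex
    accounts for at most the size of its old component. The predicate [P] lets one argument serve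
    both [Ncount] and [Nlt]. *)
Lemma count_loss (P : pred nat) h s :
  (\sum_(x : 'I_n) P #|cc h x| <= \sum_(x : 'I_n) P #|cc (rcons h s) x| +
     \sum_(j < l) #|cc h (s.1 j)| * P #|cc h (s.1 j)|)%N.
Proof.
under [X in (_ <= _ + X)%N]eq_bigr => j _ do rewrite -[X in (X * _)%N]sum_mem_comp big_distrl /=.
rewrite exchange_big -big_split; apply: leq_sum => x _ /=.
have [->|/comp_changed[j xj]] := eqVneq (cc (rcons h s) x) (cc h x).
  exact: leq_addr.
apply: leq_trans (leq_addl _ _); rewrite (bigD1 j) //= xj mul1n (comp_eq xj).
exact: leq_addr.
Qed.

(** A vertex that enters the class lies after the step in the component of a drawn vertex, so sizes
    are measured in the new graph here. *)
Lemma count_gain (P : pred nat) h s :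
  (\sum_(x : 'I_n) P #|cc (rcons h s) x| <= \sum_(x : 'I_n) P #|cc h x| +
     \sum_(j < l) #|cc (rcons h s) (s.1 j)| * P #|cc (rcons h s) (s.1 j)|)%N.
Proof.
under [X in (_ <= _ + X)%N]eq_bigr => j _ do rewrite -[X in (X * _)%N]sum_mem_comp big_distrl /=.
rewrite exchange_big -big_split; apply: leq_sum => x _ /=.
have [->|/comp_changed[j xj]] := eqVneq (cc (rcons h s) x) (cc h x).
  exact: leq_addr.
have {}xj := fintype.subsetP (comp_rcons h s (s.1 j)) _ xj.
apply: leq_trans (leq_addl _ _); rewrite (bigD1 j) //= xj mul1n (comp_eq xj).
exact: leq_addr.
Qed.

(** Recording how many drawn vertices hit size [k] makes the mean loss proportional to the count
    itself. This is the source of exponential survival. *)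
Lemma Ncount_loss h s k :
  (Ncount h k <= Ncount (rcons h s) k + k * \sum_(j < l) (#|cc h (s.1 j)| == k))%N.
Proof.
rewrite !NcountE; apply: leq_trans (count_loss (eq_op^~ k) h s) _.
rewrite leq_add2l big_distrr /=; apply: leq_sum => j _.
by case: eqP => [->|]; rewrite ?muln0.
Qed.

Lemma sum_card_le h s k (P : pred nat) : (forall c, P c -> (c <= k)%N) ->
  (\sum_(j < l) #|cc h (s.1 j)| * P #|cc h (s.1 j)| <= l * k)%N.
Proof.
move=> Pk; rewrite -[X in (_ <= X * _)%N](card_ord l) -sum_nat_const.
apply: leq_sum => j _; case: (boolP (P _)) => [/Pk|_]; first by rewrite muln1.
by rewrite muln0.
Qed.

Lemma Ncount_rcons_ge h s k : (Ncount h k <= Ncount (rcons h s) k + l * k)%N.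
Proof.
rewrite !NcountE; apply: leq_trans (count_loss (eq_op^~ k) h s) _.
by rewrite leq_add2l; apply: (@sum_card_le _ _ _ (eq_op^~ k)) => c /eqP ->.
Qed.

Lemma Ncount_rcons_le h s k : (Ncount (rcons h s) k <= Ncount h k + l * k)%N.
Proof.
rewrite !NcountE; apply: leq_trans (count_gain (eq_op^~ k) h s) _.
by rewrite leq_add2l; apply: (@sum_card_le _ _ _ (eq_op^~ k)) => c /eqP ->.
Qed.

Lemma Nlt_rcons_ge h s k : (Nlt h k <= Nlt (rcons h s) k + l * k)%N.
Proof.
apply: leq_trans (count_loss (ltn^~ k) h s) _.
by rewrite leq_add2l; apply: (@sum_card_le _ _ _ (ltn^~ k)) => c /ltnW.
Qed.

Lemma Nlt_cat h1 h2 k : (Nlt (h1 ++ h2) k <= Nlt h1 k)%N.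
Proof.
apply: leq_sum => x _; case: (ltnP #|cc (h1 ++ h2) x| k) => // ck.
by rewrite (leq_ltn_trans _ ck) // subset_leq_card // comp_cat.
Qed.

Lemma Nlt_take h m k : (Nlt h k <= Nlt (take m h) k)%N.
Proof. by rewrite -{1}(cat_take_drop m h); exact: Nlt_cat. Qed.

Lemma L1_take h m : (L1 (take m h) <= L1 h)%N.
Proof.
apply/bigmax_leqP => x _; apply: leq_trans (leq_bigmax x).
by rewrite -{2}(cat_take_drop m h) subset_leq_card // comp_cat.
Qed.

Lemma comp_le_L1 h x : (#|cc h x| <= L1 h)%N.
Proof. exact: leq_bigmax. Qed.

Lemma Nlt_le h k : (Nlt h k <= n)%N.
Proof.
rewrite -[X in (_ <= X)%N](card_ord n) -sum1_card; apply: leq_sum => x _.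
exact: leq_b1.
Qed.

Lemma Ncount_le h k : (Ncount h k <= n)%N.
Proof.
rewrite NcountE -[X in (_ <= X)%N](card_ord n) -sum1_card; apply: leq_sum => x _.
exact: leq_b1.
Qed.

Lemma Ncount_nil k : Ncount (nil : seq (step n l)) k = (n * (k == 1))%N.
Proof.
rewrite NcountE; under eq_bigr do rewrite comp_empty cards1.
by rewrite sum_nat_const card_ord eq_sym.
Qed.

Section Potential.
Variable R : realType.

(* The sum, over the components C, of min(1, |C| / k). *)
Definition potential (k : nat) h : R := \sum_(x : 'I_n) (maxn k #|cc h x|)%:R^-1.

Lemma inv_maxn_le k a b : (0 < a)%N -> (a <= b)%N ->
  (maxn k b)%:R^-1 <= (maxn k a)%:R^-1 :> R.
Proof.
move=> a0 ab; have m0 : (0 < maxn k a)%N by rewrite leq_max a0 orbT.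
have m1 : (maxn k a <= maxn k b)%N by rewrite geq_max leq_maxl leq_max ab orbT.
by rewrite lef_pV2 ?ler_nat ?posrE ?ltr0n // (leq_trans m0 m1).
Qed.

Lemma potential_rcons_le k h s : potential k (rcons h s) <= potential k h.
Proof.
apply: ler_sum => x _; apply: inv_maxn_le (card_comp_gt0 _ _) _.
exact/subset_leq_card/comp_rcons.
Qed.

Lemma potential_ge0 k h : 0 <= potential k h.
Proof. by apply: sumr_ge0 => x _; rewrite invr_ge0. Qed.

Lemma sumr_mem_comp h y : \sum_(x : 'I_n) (x \in cc h y)%:R = #|cc h y|%:R :> R.
Proof. by rewrite -natr_sum sum_mem_comp. Qed.

(** At most [l] components are touched, and each of them counts for at most 1. *)
Lemma potential_rcons_ge k h s : potential k h <= potential k (rcons h s) + l%:R.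
Proof.
(* Each unit of [l] is spread evenly over the component of one drawn vertex, which allows a
   comparison vertex by vertex. *)
have -> : l%:R = \sum_(j < l) \sum_(x : 'I_n) (x \in cc h (s.1 j))%:R / #|cc h (s.1 j)|%:R :> R.
  rewrite -[in LHS](card_ord l) -sum1_card natr_sum; apply: eq_bigr => j _.
  by rewrite -mulr_suml sumr_mem_comp divff // pnatr_eq0 -lt0n card_comp_gt0.
rewrite exchange_big -big_split; apply: ler_sum => x _ /=.
have [->|/comp_changed[j xj]] := eqVneq (cc (rcons h s) x) (cc h x).
  by rewrite lerDl; apply: sumr_ge0 => j _; rewrite divr_ge0.
rewrite (bigD1 j) //= xj (comp_eq xj) mul1r.
apply: ler_wpDl; first by rewrite invr_ge0.
apply: ler_wpDr; first by apply: sumr_ge0 => i _; rewrite divr_ge0.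
have c0 := card_comp_gt0 h (s.1 j).
by rewrite lef_pV2 ?posrE ?ltr0n ?ler_nat ?leq_maxr // leq_max c0 orbT.
Qed.

(** If components of sizes [A] and [B] end up in one of size [C >= A + B], their vertices together
    lose [2 - (A + B) / C], hence at least 1; all other vertices can only lose. *)
Lemma potential_merge k h s : distinct_comps h s.1 -> nonempty_pairs s.2 ->
  (forall j, (k <= #|cc h (s.1 j)|)%N) ->
  potential k (rcons h s) <= potential k h - 1.
Proof.
move=> dist /existsP[p /andP[ps pne]] kc.
set h' := rcons h s; set a := s.1 p.1; set b := s.1 p.2.
have ab : b \in cc h' a.
  rewrite inE; apply: connect1; rewrite /hadj has_rcons; apply/orP; left.
  by apply/existsP; exists p; rewrite ps !eqxx.
have eab : cc h' b = cc h' a by exact: comp_eq.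
have disj x : x \in cc h a -> (x \in cc h b) = false.
  rewrite !inE => ax; apply/negP => bx; have /negP := dist _ _ pne; apply.
  by apply: connect_trans ax _; rewrite hconnect_sym.
have disj0 : #|cc h a :&: cc h b| = 0%N.
  by apply/eqP; rewrite cards_eq0; apply/eqP/finset.setP => x; rewrite !inE;
    apply/andP => -[xa]; have := disj x; rewrite !inE => ->.
set A : R := #|cc h a|%:R; set B : R := #|cc h b|%:R; set C : R := #|cc h' a|%:R.
have A0 : 0 < A by rewrite ltr0n card_comp_gt0.
have B0 : 0 < B by rewrite ltr0n card_comp_gt0.
have ABC : A + B <= C.
  rewrite -natrD ler_nat -cardsUI disj0 addn0.
  apply: subset_leq_card; rewrite finset.subUset comp_rcons.
  by have := comp_rcons h s b; rewrite -/h' eab.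
have C0 : 0 < C by apply: lt_le_trans ABC; rewrite addr_gt0.
have key (y : 'I_n) : y = a \/ y = b -> forall x, x \in cc h y ->
    (maxn k #|cc h x|)%:R^-1 - (maxn k #|cc h' x|)%:R^-1 = (#|cc h y|%:R : R)^-1 - C^-1.
  move=> yab x xy; have xy' := fintype.subsetP (comp_rcons h s y) _ xy.
  have ky : (k <= #|cc h y|)%N by case: yab => ->; exact: kc.
  have ey : cc h' y = cc h' a by case: yab => ->.
  have kC : (k <= #|cc h' a|)%N.
    by apply: leq_trans (kc p.1) _; rewrite subset_leq_card // comp_rcons.
  by rewrite (comp_eq xy) (comp_eq xy') ey (maxn_idPr ky) (maxn_idPr kC).
rewrite lerBrDr -lerBrDl -sumrB.
apply: le_trans (_ : \sum_(x : 'I_n) ((x \in cc h a)%:R * (A^-1 - C^-1)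
    + (x \in cc h b)%:R * (B^-1 - C^-1)) <= _).
  rewrite big_split /= -!mulr_suml !sumr_mem_comp -/A -/B.
  rewrite !mulrBr !divff ?gt_eqF //.
  have : (A + B) / C <= 1 by rewrite ler_pdivrMr // mul1r.
  rewrite mulrDl; lra.
apply: ler_sum => x _.
have := inv_maxn_le k (card_comp_gt0 h x) (subset_leq_card (comp_rcons h s x)).
rewrite -/h' => mono.
case: (boolP (x \in cc h a)) => xa.
  rewrite (disj x xa) mul0r addr0 mul1r (key a) //; last by left.
case: (boolP (x \in cc h b)) => xb.
  by rewrite mul0r add0r mul1r (key b) //; right.
by rewrite !mul0r addr0 subr_ge0.
Qed.

(** Every vertex weighs at most [1 / k], and at most [1 / b] if its component has size at least [b].
    For [b] a large multiple of [k], big components are thus negligible at scale [n / k]. *)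
Lemma potential_le k h b : (0 < k)%N -> (0 < b)%N ->
  potential k h <= (Nlt h b)%:R / k%:R + n%:R / b%:R.
Proof.
move=> k0 b0; rewrite natr_sum mulr_suml.
have -> : n%:R / b%:R = \sum_(x : 'I_n) b%:R^-1 :> R.
  by rewrite sumr_const card_ord mulr_natl.
rewrite -big_split; apply: ler_sum => x _ /=.
case: ltnP => [_|bc].
  rewrite mul1r ler_wpDr ?invr_ge0 // lef_pV2 ?posrE ?ltr0n ?ler_nat ?leq_maxl //.
  by rewrite leq_max k0.
rewrite mul0r add0r lef_pV2 ?posrE ?ltr0n ?ler_nat ?leq_max ?bc ?orbT //.
by rewrite card_comp_gt0 orbT.
Qed.

Lemma potential_ge k h a : (a <= k)%N -> (Nlt h a)%:R / k%:R <= potential k h.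
Proof.
move=> ak; rewrite natr_sum mulr_suml; apply: ler_sum => x _.
case: ltnP => [ca|_]; last by rewrite mul0r invr_ge0.
by rewrite mul1r (maxn_idPl (ltnW (leq_trans ca ak))).
Qed.

End Potential.

End Components.

(** * Means over steps and histories *)

Section Process.
Variables (R : realType) (l : nat) (r : rule R l) (n : nat).
Hypotheses (hvalid : valid_rule r) (n_gt0 : (0 < n)%N).
Implicit Types (h : seq (step n l)) (s : step n l) (v : {ffun 'I_l -> 'I_n}).

Definition step_prob h s : R := n%:R ^- l * r h s.1 s.2.

Definition step_mean h (g : step n l -> R) : R := \sum_s step_prob h s * g s.

Definition tuple_mean (g : {ffun 'I_l -> 'I_n} -> R) : R := n%:R ^- l * \sum_v g v.

Let n_neq0 : n%:R != 0 :> R. Proof. by rewrite pnatr_eq0 -lt0n. Qed.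

Lemma step_prob_ge0 h s : 0 <= step_prob h s.
Proof. by rewrite mulr_ge0 ?invr_ge0 ?exprn_ge0 //; case: (hvalid h s.1). Qed.

Lemma step_meanE h g :
  step_mean h g = tuple_mean (fun v => \sum_E r h v E * g (v, E)).
Proof.
rewrite /step_mean /tuple_mean mulr_sumr.
rewrite (eq_bigr (fun q => step_prob h (q.1, q.2) * g (q.1, q.2))); last by case.
rewrite -(pair_bigA _ (fun v E => step_prob h (v, E) * g (v, E))) /=.
by apply: eq_bigr => v _; rewrite mulr_sumr; apply: eq_bigr => E _; rewrite mulrA.
Qed.

Lemma step_mean_fst h g : step_mean h (fun s => g s.1) = tuple_mean g.
Proof.
rewrite step_meanE; congr (_ * _); apply: eq_bigr => v _ /=.
by rewrite -mulr_suml; case: (hvalid h v) => _ -> _; rewrite mul1r.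
Qed.

Lemma tuple_mean_prod (F : 'I_l -> 'I_n -> R) :
  tuple_mean (fun v => \prod_j F j (v j)) = \prod_j ((\sum_x F j x) / n%:R).
Proof.
by rewrite /tuple_mean -bigA_distr_bigA prodf_div prodr_const card_ord mulrC.
Qed.

Lemma tuple_mean_coord (j : 'I_l) (F : 'I_n -> R) :
  tuple_mean (fun v => F (v j)) = (\sum_x F x) / n%:R.
Proof.
transitivity (tuple_mean (fun v => \prod_i (if i == j then F (v i) else 1))).
  by congr (_ * _); apply: eq_bigr => v _; rewrite -big_mkcond big_pred1_eq.
rewrite (tuple_mean_prod (fun i x => if i == j then F x else 1)).
rewrite (bigD1 j) //= eqxx [X in _ * X]big1 ?mulr1 // => i /negbTE ->.
by rewrite sumr_const card_ord divff.
Qed.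

Lemma tuple_mean_coord2 (i j : 'I_l) (F G : 'I_n -> R) : i != j ->
  tuple_mean (fun v => F (v i) * G (v j)) = (\sum_x F x) / n%:R * ((\sum_x G x) / n%:R).
Proof.
move=> ij; pose H (m : 'I_l) x := if m == i then F x else if m == j then G x else 1.
transitivity (tuple_mean (fun v => \prod_m H m (v m))).
  congr (_ * _); apply: eq_bigr => v _; rewrite (bigD1 i) //= (bigD1 j) 1?eq_sym //=.
  rewrite /H eqxx eq_sym (negbTE ij) eqxx [X in _ = _ * (_ * X)]big1 ?mulr1 // => m /andP[].
  by move=> /negbTE -> /negbTE ->.
rewrite tuple_mean_prod (bigD1 i) //= (bigD1 j) 1?eq_sym //=.
rewrite [X in _ * (_ * X)]big1 ?mulr1.
  by rewrite /H eqxx eq_sym (negbTE ij) eqxx.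
move=> m /andP[] /negbTE mi /negbTE mj; rewrite /H mi mj.
by rewrite sumr_const card_ord divff.
Qed.

Lemma tuple_mean_le g1 g2 : (forall v, g1 v <= g2 v) -> tuple_mean g1 <= tuple_mean g2.
Proof. by move=> g12; rewrite ler_wpM2l ?invr_ge0 ?exprn_ge0 // ler_sum. Qed.

Lemma tuple_mean_sum (I : Type) (t : seq I) (P : pred I) (g : I -> _ -> R) :
  tuple_mean (fun v => \sum_(i <- t | P i) g i v) = \sum_(i <- t | P i) tuple_mean (g i).
Proof. by rewrite /tuple_mean exchange_big mulr_sumr. Qed.

Lemma tuple_meanD g1 g2 :
  tuple_mean (fun v => g1 v + g2 v) = tuple_mean g1 + tuple_mean g2.
Proof. by rewrite /tuple_mean big_split mulrDr. Qed.

Lemma tuple_meanZ a g : tuple_mean (fun v => a * g v) = a * tuple_mean g.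
Proof. by rewrite /tuple_mean -mulr_sumr mulrCA. Qed.

Lemma tuple_meanB g1 g2 :
  tuple_mean (fun v => g1 v - g2 v) = tuple_mean g1 - tuple_mean g2.
Proof. by rewrite /tuple_mean sumrB mulrBr. Qed.

Lemma step_meanD h g1 g2 :
  step_mean h (fun s => g1 s + g2 s) = step_mean h g1 + step_mean h g2.
Proof. by rewrite /step_mean -big_split; apply: eq_bigr => s _; rewrite mulrDr. Qed.

Lemma step_meanZ h a g : step_mean h (fun s => a * g s) = a * step_mean h g.
Proof. by rewrite /step_mean mulr_sumr; apply: eq_bigr => s _; rewrite mulrCA. Qed.

Lemma step_mean_const h a : step_mean h (fun=> a) = a.
Proof.
rewrite (step_mean_fst h (fun=> a)) /tuple_mean sumr_const card_ffun !card_ord.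
by rewrite -[a *+ _]mulr_natr natrX mulrCA mulVf ?mulr1 // expf_neq0.
Qed.

Lemma step_mean_le h g1 g2 : (forall s, 0 < step_prob h s -> g1 s <= g2 s) ->
  step_mean h g1 <= step_mean h g2.
Proof.
move=> g12; apply: ler_sum => s _; have := step_prob_ge0 h s.
rewrite le_eqVlt => /orP[/eqP <-|p0]; first by rewrite !mul0r.
by rewrite ler_pM2l // g12.
Qed.

Definition hist_mean (m : nat) h (F : seq (step n l) -> R) : R :=
  \sum_(t : m.-tuple (step n l)) hw r h t * F (h ++ t).

Lemma hist_mean0 h F : hist_mean 0 h F = F h.
Proof.
rewrite /hist_mean (big_pred1 [tuple]) ?cats0 ?mul1r // => t.
by apply/esym/eqP/val_inj; rewrite /= tuple0.
Qed.

Lemma hist_meanS m h F :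
  hist_mean m.+1 h F = step_mean h (fun s => hist_mean m (rcons h s) F).
Proof.
rewrite /hist_mean /step_mean.
transitivity (\sum_(q : step n l * m.-tuple (step n l))
    hw r h (q.1 :: q.2) * F (h ++ q.1 :: q.2)).
  rewrite (reindex (fun q : step n l * m.-tuple (step n l) => [tuple of q.1 :: q.2])) //.
  exists (fun t => (thead t, [tuple of behead t])) => [[s t] _|t _].
    by congr (_, _); apply: val_inj.
  by rewrite -tuple_eta.
rewrite -(pair_bigA _ (fun s (t : m.-tuple (step n l)) =>
    hw r h (s :: t) * F (h ++ s :: t))) /=.
apply: eq_bigr => s _; rewrite mulr_sumr; apply: eq_bigr => t _.
by rewrite cat_rcons mulrA.
Qed.

Lemma hw_ge0 h t : 0 <= hw r h t.
Proof.
elim: t h => [|s t IH] h /=; first exact: ler01.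
by rewrite mulr_ge0 //; exact: step_prob_ge0.
Qed.

Lemma hw_cat h t1 t2 : hw r h (t1 ++ t2) = hw r h t1 * hw r (h ++ t1) t2.
Proof.
elim: t1 h => [|s t IH] h /=; first by rewrite cats0 mul1r.
by rewrite IH cat_rcons !mulrA.
Qed.

Lemma weight_take_gt0 h m : 0 < weight r h -> 0 < weight r (take m h).
Proof.
rewrite /weight -{1}(cat_take_drop m h) hw_cat => pos.
rewrite lt0r hw_ge0 andbT; apply/eqP => e0.
by move: pos; rewrite e0 mul0r ltxx.
Qed.

Section Martingale.
Variables (f : seq (step n l) -> R) (A : R).
Hypothesis f_lip : forall h s, `|f (rcons h s) - f h| <= A.

Definition drift_of h : R := step_mean h (fun s => f (rcons h s) - f h).

(** The martingale part in the Doob decomposition of [f] along the history. *)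
Definition mart h : R := f h - f [::] - \sum_(i < size h) drift_of (take i h).

Lemma mart_nil : mart [::] = 0.
Proof. by rewrite /mart big_ord0 subrr subr0. Qed.

Lemma mart_rcons h s : mart (rcons h s) = mart h + (f (rcons h s) - f h - drift_of h).
Proof.
rewrite /mart size_rcons big_ord_recr /=.
rewrite -cats1 take_size_cat //.
under eq_bigr => i _ do rewrite takel_cat ?(ltnW (ltn_ord i)) //.
ring.
Qed.

Lemma drift_of_le h : `|drift_of h| <= A.
Proof.
rewrite ler_norml; apply/andP; split.
  rewrite -(step_mean_const h (- A)); apply: step_mean_le => s _.
  by have := f_lip h s; rewrite ler_norml => /andP[].
rewrite -(step_mean_const h A); apply: step_mean_le => s _.
by have := f_lip h s; rewrite ler_norml => /andP[].
Qed.

Lemma mart_lip h s : `|mart (rcons h s) - mart h| <= 2 * A.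
Proof.
rewrite mart_rcons addrAC subrr add0r (le_trans (ler_normB _ _)) //.
by rewrite mulr_natl mulr2n lerD // drift_of_le.
Qed.

Lemma mart_mean h : step_mean h (fun s => mart (rcons h s) - mart h) = 0.
Proof.
transitivity (step_mean h (fun s => (f (rcons h s) - f h) + - drift_of h)).
  by apply: eq_bigr => s _; rewrite mart_rcons; congr (_ * _); ring.
by rewrite step_meanD step_mean_const subrr.
Qed.

Lemma mart_sq_step h :
  step_mean h (fun s => mart (rcons h s) ^+ 2) <= mart h ^+ 2 + (2 * A) ^+ 2.
Proof.
set B := 2 * A.
apply: le_trans (_ : step_mean h (fun s => mart h ^+ 2 + B ^+ 2 +
    (2 * mart h) * (mart (rcons h s) - mart h)) <= _).
  apply: step_mean_le => s _; have := mart_lip h s; rewrite -/B.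
  rewrite ler_norml; nra.
by rewrite step_meanD step_meanZ mart_mean mulr0 addr0 step_mean_const.
Qed.

(** In the expansion of [(x + y) ^+ 4] the term linear in [y] has mean zero, and
    [4xy^3 <= 2x^2y^2 + 2y^4] absorbs the cubic one. This leaves [8x^2y^2 + 3y^4] with
    [|y| <= B]. *)
Lemma mart_fourth_step h :
  step_mean h (fun s => mart (rcons h s) ^+ 4) <=
    mart h ^+ 4 + 8 * (2 * A) ^+ 2 * mart h ^+ 2 + 3 * (2 * A) ^+ 4.
Proof.
set B := 2 * A.
apply: le_trans (_ : step_mean h (fun s => (mart h ^+ 4 + 8 * B ^+ 2 * mart h ^+ 2
    + 3 * B ^+ 4) + (4 * mart h ^+ 3) * (mart (rcons h s) - mart h)) <= _).
  apply: step_mean_le => s _; have := mart_lip h s; rewrite -/B.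
  set x := mart h; have -> : mart (rcons h s) = x + (mart (rcons h s) - x) by ring.
  move: (mart _ - x) => y; rewrite [x + y - x]addrC addKr => yB.
  have y2 : y ^+ 2 <= B ^+ 2 by move: yB; rewrite ler_norml; nra.
  have y4 : y ^+ 4 <= B ^+ 4.
    rewrite -subr_ge0 (_ : _ - _ = (B ^+ 2 - y ^+ 2) * (B ^+ 2 + y ^+ 2)); last by ring.
    by rewrite mulr_ge0 ?subr_ge0 // addr_ge0 ?sqr_ge0.
  have xy : x ^+ 2 * y ^+ 2 <= x ^+ 2 * B ^+ 2 by rewrite ler_wpM2l ?sqr_ge0.
  have q : 0 <= (x * y - y ^+ 2) ^+ 2 by exact: sqr_ge0.
  rewrite -subr_ge0.
  suff : 0 <= 8 * (x ^+ 2 * B ^+ 2 - x ^+ 2 * y ^+ 2) + 3 * (B ^+ 4 - y ^+ 4) + 2 * (x * y - y ^+ 2) ^+ 2.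
    move=> H; apply: le_trans H _; rewrite le_eqVlt; apply/orP; left; apply/eqP; ring.
  by apply: addr_ge0; [apply: addr_ge0|]; rewrite mulr_ge0 ?subr_ge0.
by rewrite step_meanD step_meanZ mart_mean mulr0 addr0 step_mean_const.
Qed.

(** Summing over all prefixes makes a bound on this one quantity a bound at every time
    simultaneously. *)
Definition mart_energy h : R := \sum_(i < (size h).+1) mart (take i h) ^+ 4.

Lemma mart_energy_rcons h s :
  mart_energy (rcons h s) = mart_energy h + mart (rcons h s) ^+ 4.
Proof.
rewrite /mart_energy size_rcons big_ord_recr /= take_oversize ?size_rcons //.
congr (_ + _); apply: eq_bigr => i _; rewrite -cats1 takel_cat //.
by rewrite -ltnS.
Qed.

(** Induction on the remaining steps, conditioning on the first one. The polynomial on the right is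
    chosen so that the induction closes: the one-step bounds leave a nonnegative remainder. From the
    empty history it is of order [m ^+ 3]. *)
Lemma mart_energy_mean m h :
  hist_mean m h mart_energy <= mart_energy h +
    m%:R * (mart h ^+ 4 + 8 * (2 * A) ^+ 2 * m%:R * mart h ^+ 2 + 8 * (2 * A) ^+ 4 * m%:R ^+ 2).
Proof.
set B := 2 * A.
elim: m h => [|m IH] h; first by rewrite hist_mean0 mul0r addr0.
rewrite hist_meanS.
apply: le_trans (_ : step_mean h (fun s => (mart_energy h + 8 * B ^+ 4 * m%:R ^+ 3) +
  (m.+1%:R * mart (rcons h s) ^+ 4 + (8 * B ^+ 2 * m%:R ^+ 2) * mart (rcons h s) ^+ 2)) <= _).
  apply: step_mean_le => s _; apply: le_trans (IH _) _.
  rewrite mart_energy_rcons -natr1 le_eqVlt; apply/orP; left.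
  apply/eqP; ring.
rewrite step_meanD step_mean_const step_meanD !step_meanZ.
have m1 : 0 <= m.+1%:R :> R by [].
have m2 : 0 <= 8 * B ^+ 2 * m%:R ^+ 2.
  by apply: mulr_ge0 (sqr_ge0 _); apply: mulr_ge0 (sqr_ge0 _).
have := ler_wpM2l m1 (mart_fourth_step h); have := ler_wpM2l m2 (mart_sq_step h).
rewrite -/B -!natr1 => H1 H2; rewrite -addrA lerD2l.
apply: le_trans (lerD (lexx _) (lerD H2 H1)) _; rewrite -subr_ge0.
set x := mart h; set y := m%:R.
have y0 : 0 <= y by [].
suff : 0 <= B ^+ 4 * (5 + 21 * y + 16 * y ^+ 2) + 8 * B ^+ 2 * y * x ^+ 2.
  move=> H; apply: le_trans H _; rewrite le_eqVlt; apply/orP; left; apply/eqP.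
  rewrite -/y; ring.
have B4 : 0 <= B ^+ 4 by rewrite (_ : B ^+ 4 = (B ^+ 2) ^+ 2) ?sqr_ge0 // -exprM.
apply: addr_ge0; last first.
  by apply: mulr_ge0 (sqr_ge0 _); apply: mulr_ge0 y0; apply: mulr_ge0 (sqr_ge0 _).
by apply: mulr_ge0 => //; nra.
Qed.

End Martingale.

End Process.

(** * Drifts *)

Section Drift.
Variables (R : realType) (l : nat) (r : rule R l) (n : nat).
Hypotheses (hvalid : valid_rule r) (n_gt0 : (0 < n)%N).
Implicit Types (h : seq (step n l)) (s : step n l) (v : {ffun 'I_l -> 'I_n}).

Let n_neq0 : n%:R != 0 :> R. Proof. by rewrite pnatr_eq0 -lt0n. Qed.

Lemma Ncount_lip k h s :
  `|(Ncount (rcons h s) k)%:R - (Ncount h k)%:R| <= (l * k)%:R :> R.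
Proof.
have := Ncount_rcons_ge h s k; have := Ncount_rcons_le h s k.
by rewrite -!(ler_nat R) !natrD ler_norml => *; apply/andP; split; lra.
Qed.

Lemma potential_lip k h s :
  `|potential R k (rcons h s) - potential R k h| <= l%:R.
Proof.
rewrite ler_norml; have := potential_rcons_le R k h s.
have := potential_rcons_ge R k h s; have : 0 <= l%:R :> R by [].
by move=> *; apply/andP; split; lra.
Qed.

Definition Ndrift k h := drift_of r (fun h => (Ncount h k)%:R) h.
Definition Xdrift k h := drift_of r (potential R k) h.

Lemma sum_Ncount_eq h k : (Ncount h k)%:R = \sum_(x : 'I_n) (#|cc h x| == k)%:R :> R.
Proof. by rewrite NcountE natr_sum. Qed.

(** Each of the [l] drawn vertices hits a component of size [k] with probability [Ncount h k / n],
    and then costs at most [k] vertices. *)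
Lemma Ndrift_ge k h : - ((l * k)%:R * ((Ncount h k)%:R / n%:R)) <= Ndrift k h.
Proof.
have -> : - ((l * k)%:R * ((Ncount h k)%:R / n%:R)) =
    step_mean r h (fun s => - k%:R * \sum_(j < l) (#|cc h (s.1 j)| == k)%:R).
  rewrite step_meanZ (step_mean_fst hvalid h (fun v => \sum_(j < l) (#|cc h (v j)| == k)%:R)).
  rewrite tuple_mean_sum.
  under eq_bigr => j _ do
    rewrite (tuple_mean_coord n_gt0 j (fun x => (#|cc h x| == k)%:R : R)) -sum_Ncount_eq.
  by rewrite sumr_const card_ord -mulr_natl natrM; ring.
apply: (step_mean_le hvalid) => s _; rewrite -natr_sum mulNr -natrM lerBrDr addrC.
by rewrite lerBlDr -natrD ler_nat Ncount_loss.
Qed.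

Definition bad_tuple h v : R := (~~ `[< distinct_comps h v >])%:R.

(** Given one drawn vertex, another one falls into its component with probability at most [L1 / n];
    a union bound over pairs of positions gives the factor [l ^ 2]. *)
Lemma bad_tuple_mean h : tuple_mean (bad_tuple h) <= (l ^ 2)%:R * ((L1 h)%:R / n%:R).
Proof.
have step1 v : bad_tuple h v <=
    \sum_(i < l) \sum_(j < l | j != i) (connect (hadj h) (v i) (v j))%:R.
  rewrite /bad_tuple; case: asboolP => [_|nd] /=.
    by apply: sumr_ge0 => i _; apply: sumr_ge0.
  have [i [j [ij c]]] : exists i j, i != j /\ connect (hadj h) (v i) (v j).
    move/existsNP: nd => [i /existsNP[j /not_implyP[ij /negP]]].
    by rewrite negbK => c; exists i, j.
  rewrite (bigD1 i) //= (bigD1 j) 1?eq_sym //= c -addrA lerDl addr_ge0 ?sumr_ge0 //.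
  by move=> a _; apply: sumr_ge0.
apply: le_trans (tuple_mean_le step1) _.
rewrite tuple_mean_sum.
have pair i j : i != j ->
    tuple_mean (fun v => (connect (hadj h) (v i) (v j))%:R) <= (L1 h)%:R / n%:R :> R.
  move=> ij.
  (* Splitting by the value of [v i] turns the indicator into products of functions of independent
     coordinates. *)
  rewrite [X in X <= _](_ : _ =
      tuple_mean (fun v => \sum_(x : 'I_n) (v i == x)%:R * (v j \in cc h x)%:R)); last first.
    congr (_ * _); apply: eq_bigr => v _.
    rewrite (bigD1 (v i)) //= eqxx mul1r inE big1 ?addr0 // => x /negbTE.
    by rewrite eq_sym => ->; rewrite mul0r.
  rewrite tuple_mean_sum.
  under eq_bigr => x _ do rewrite (tuple_mean_coord2 n_gt0 (fun y => (y == x)%:R : R)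
     (fun y => (y \in cc h x)%:R : R) ij) sumr_mem_comp.
  have sum1 (x : 'I_n) : \sum_y (y == x)%:R = 1 :> R.
    rewrite (bigD1 x) //= eqxx big1 ?addr0 // => y /negbTE ->; by [].
  under eq_bigr do rewrite sum1.
  have -> : (L1 h)%:R / n%:R = \sum_(x : 'I_n) n%:R^-1 * ((L1 h)%:R / n%:R) :> R.
    by rewrite sumr_const card_ord -[RHS]mulr_natl mulrA divff ?mul1r.
  apply: ler_sum => x _; rewrite mul1r ler_wpM2l ?invr_ge0 //.
  by rewrite ler_wpM2r ?invr_ge0 // ler_nat comp_le_L1.
have -> : (l ^ 2)%:R * ((L1 h)%:R / n%:R) = \sum_(i < l) \sum_(j < l) (L1 h)%:R / n%:R :> R.
  rewrite !sumr_const !card_ord -[RHS]mulr_natl -[in RHS](mulr_natl (_ / _)).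
  by rewrite [RHS]mulrA -natrM mulnn.
apply: ler_sum => i _; rewrite tuple_mean_sum [X in _ <= X](bigID (fun j => j != i)) /=.
rewrite ler_wpDr //; first by apply: sumr_ge0 => j _; rewrite divr_ge0.
by apply: ler_sum => j ji; apply: pair; rewrite eq_sym.
Qed.

Lemma sum_Nlt_ge h k :
  \sum_(x : 'I_n) (k <= #|cc h x|)%:R = n%:R - (Nlt h k)%:R :> R.
Proof.
apply/eqP; rewrite eq_sym subr_eq; apply/eqP.
rewrite /Nlt natr_sum -big_split /= -{1}(card_ord n) -sum1_card natr_sum.
by apply: eq_bigr => x _; case: ltnP; rewrite ?add0r ?addr0.
Qed.

(** All drawn vertices lie in components of size at least [k] with probability [(1 - Nlt / n) ^+ l].
    Unless two of them share a component, the rule must then merge and the potential loses 1; in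
    every other case it does not increase. *)
Lemma Xdrift_le k h :
  Xdrift k h <= - (1 - (Nlt h k)%:R / n%:R) ^+ l + (l ^ 2)%:R * ((L1 h)%:R / n%:R).
Proof.
apply: le_trans (_ : - (1 - (Nlt h k)%:R / n%:R) ^+ l + tuple_mean (bad_tuple h) <= _);
  last by rewrite lerD2l bad_tuple_mean.
have -> : (1 - (Nlt h k)%:R / n%:R) ^+ l =
    tuple_mean (fun v => \prod_(j < l) (k <= #|cc h (v j)|)%:R) :> R.
  rewrite (tuple_mean_prod (fun _ x => (k <= #|cc h x|)%:R)).
  by rewrite prodr_const card_ord sum_Nlt_ge mulrBl divff.
rewrite addrC -tuple_meanB -(step_mean_fst hvalid h).
apply: (step_mean_le hvalid) => s p0.
(* [valid_rule] forces a nonempty set of pairs only on outcomes of positive probability. *)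
have r0 : 0 < r h s.1 s.2.
  by move: p0; rewrite /step_prob pmulr_rgt0 // invr_gt0 exprn_gt0 ?ltr0n.
have mono := potential_rcons_le R k h s.
have [all|/existsNP[j /negP]] := pselect (forall j, k <= #|cc h (s.1 j)|)%N; last first.
  move=> kj; rewrite (bigD1 j) //= (negbTE kj) mul0r subr0.
  by apply: le_trans (_ : 0 <= _) => //; rewrite subr_le0.
rewrite big1 => [|j _]; last by rewrite all.
rewrite /bad_tuple; case: asboolP => [dist|_] /=; last by rewrite subrr subr_le0.
have [_ _ ne] := hvalid h s.1.
have := potential_merge R dist (ne dist _ r0) all; lra.
Qed.

End Drift.

(** * The drift of the counts as a truncated sum over component sizes *)

Section BoxDrift.
Variables (R : realType) (l : nat) (r : rule R l) (d : nat -> ('I_l -> nat) -> R).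
Hypotheses (hvalid : valid_rule r) (hdrift : drift r d).

(* [d k c] is unconstrained at size tuples [c] never realised by the process. *)
Definition clip k c : R := if `|d k c| <= (l * k)%:R then d k c else 0.

Lemma clip_le k c : `|clip k c| <= (l * k)%:R.
Proof. by rewrite /clip; case: ifP => // _; rewrite normr0. Qed.

Lemma Ncount_change_le n (h : seq (step n l)) v k :
  `|\sum_E r h v E * ((Ncount (rcons h (v, E)) k)%:R - (Ncount h k)%:R)| <= (l * k)%:R.
Proof.
have [r0 r1 _] := hvalid h v.
have -> : (l * k)%:R = \sum_E r h v E * (l * k)%:R by rewrite -mulr_suml r1 mul1r.
apply: le_trans (ler_norm_sum _ _ _) _; apply: ler_sum => E _.
by rewrite normrM ger0_norm // ler_wpM2l // Ncount_lip.
Qed.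

(** At a realised size tuple [d] is a mean of changes bounded by [l * k], so clipping does not
    affect it. *)
Lemma drift_clip n (h : seq (step n l)) v k : 0 < weight r h -> distinct_comps h v ->
  (0 < k)%N -> d k (fun j => #|cc h (v j)|) = clip k (fun j => #|cc h (v j)|).
Proof.
move=> h0 dist k0; by rewrite /clip -(hdrift h0 dist k0) ifT // Ncount_change_le.
Qed.

(** By independence of the coordinates, the product of densities is the probability that the drawn
    vertices have component sizes [c]. The box only sees tuples whose sizes are all at most [B]. *)
Lemma box_sum_tuple_mean n (h : seq (step n l)) (F : ('I_l -> nat) -> R) B : (0 < n)%N ->
  box_sum (fun c => F c * \prod_(j < l) ((Ncount h (c j))%:R / n%:R)) B =
  tuple_mean (fun v => (\prod_(j < l) (#|cc h (v j)| <= B)%N%:R) * F (fun j => #|cc h (v j)|)).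
Proof.
move=> n0; rewrite /box_sum.
transitivity (\sum_(c : {ffun 'I_l -> 'I_B}) tuple_mean (fun v : {ffun 'I_l -> 'I_n} =>
    F (fun j => (c j).+1) * \prod_(j < l) (#|cc h (v j)| == (c j).+1)%:R)).
  apply: eq_bigr => c _.
  rewrite tuple_meanZ (tuple_mean_prod (fun j x => (#|cc h x| == (c j).+1)%:R)).
  by congr (_ * _); apply: eq_bigr => j _; rewrite sum_Ncount_eq.
rewrite -tuple_mean_sum; congr (_ * _); apply: eq_bigr => v _.
have [all|/existsNP[j /negP]] := pselect (forall j, #|cc h (v j)| <= B)%N; last first.
  move=> Bj; rewrite [in RHS](bigD1 j) //= (negbTE Bj) !mul0r.
  apply: big1 => c _; rewrite (bigD1 j) //=; case: eqP => [e|]; last by rewrite mul0r mulr0.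
  by move: Bj; rewrite e ltn_ord.
rewrite [in RHS]big1 ?mul1r => [|j _]; last by rewrite all.
have lt j : (#|cc h (v j)|.-1 < B)%N by rewrite prednK ?card_comp_gt0.
(* [box_sum] encodes a size by its predecessor. *)
pose c0 := [ffun j => Ordinal (lt j)].
have c0E j : (c0 j).+1 = #|cc h (v j)| by rewrite ffunE /= prednK ?card_comp_gt0.
rewrite (bigD1 c0) //= [X in _ + X]big1 ?addr0.
  rewrite (_ : (fun j => (c0 j).+1) = (fun j => #|cc h (v j)|)); last exact/funext.
  by rewrite big1 ?mulr1 // => j _; rewrite c0E eqxx.
move=> c; have [//|/existsNP[j]] := pselect (forall j, c j = c0 j).
  by move=> e; rewrite (_ : c = c0) ?eqxx //; apply/ffunP.
move=> cj _; rewrite (bigD1 j) //= -c0E eqSS eq_sym; case: eqP => [/val_inj//|_].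
by rewrite mul0r mulr0.
Qed.

(** There are two sources of error: tuples with two vertices in one component, where the true drift
    and the clipped value are each bounded by [l * k] (hence the 2), and tuples hitting a component
    larger than [B]. *)
Lemma Ndrift_box n (h : seq (step n l)) k B : (0 < n)%N -> 0 < weight r h -> (0 < k)%N ->
  `|Ndrift r k h - box_sum (fun c => clip k c * \prod_(j < l) ((Ncount h (c j))%:R / n%:R)) B|
  <= (l * k)%:R * (2 * (l ^ 2)%:R * ((L1 h)%:R / n%:R)
       + l%:R * (1 - (Nlt h B.+1)%:R / n%:R)).
Proof.
move=> n0 h0 k0; rewrite box_sum_tuple_mean // /Ndrift /drift_of step_meanE -tuple_meanB.
have lk0 : 0 <= (l * k)%:R :> R by [].
apply: le_trans (_ : tuple_mean (fun v => (l * k)%:R * (2 * bad_tuple R h v +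
   \sum_(j < l) (B.+1 <= #|cc h (v j)|)%N%:R)) <= _); last first.
  rewrite tuple_meanZ tuple_meanD tuple_meanZ tuple_mean_sum ler_wpM2l //.
  apply: lerD; first by rewrite -mulrA ler_pM2l // bad_tuple_mean.
  under eq_bigr => j _ do rewrite (tuple_mean_coord n0 j (fun x => (B.+1 <= #|cc h x|)%N%:R : R)) sum_Nlt_ge.
  by rewrite sumr_const card_ord mulrBl divff ?mulr_natl // pnatr_eq0 -lt0n.
rewrite /tuple_mean normrM ger0_norm ?invr_ge0 ?exprn_ge0 // ler_wpM2l ?invr_ge0 ?exprn_ge0 //.
apply: le_trans (ler_norm_sum _ _ _) _; apply: ler_sum => v _.
set S := \sum_E _; set D := clip _ _; set P := \prod_j _; set T := \sum_j _.
have T0 : 0 <= T by apply: sumr_ge0.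
have Sk : `|S| <= (l * k)%:R by exact: Ncount_change_le.
have PT : `|1 - P| <= T /\ `|P| <= 1.
  rewrite /P /T.
  have [all|/existsNP[j /negP]] := pselect (forall j, #|cc h (v j)| <= B)%N.
    by rewrite big1 => [|j _]; [rewrite subrr normr0 normr1|rewrite all].
  rewrite -ltnNge => Bj; rewrite (bigD1 j) //= leqNgt Bj mul0r subr0 normr1 normr0.
  by split => //; rewrite (bigD1 j) //= Bj lerDl; apply: sumr_ge0.
have Dk : `|D| <= (l * k)%:R by exact: clip_le.
have [PT1 P1] := PT.
rewrite /bad_tuple; case: asboolP => [dist|_] /=.
  have -> : S = D by rewrite /S hdrift // drift_clip.
  rewrite mulr0 add0r -{1}[D]mul1r -mulrBl normrM mulrC.
  by apply: ler_pM.
rewrite mulr1 (le_trans (ler_normB _ _)) // mulrDr mulr_natr mulr2n -addrA lerD //.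
apply: ler_wpDr; first by rewrite mulr_ge0.
by rewrite normrM -[X in _ <= X]mul1r ler_pM.
Qed.

End BoxDrift.

(** * Typical histories *)

Section Selection.
Variables (R : realType) (l : nat) (r : rule R l).
Hypothesis hvalid : valid_rule r.

Lemma prob_hist_mean n m (P : pred (seq (step n l))) :
  prob r n m P = hist_mean r m [::] (fun h => (P h)%:R).
Proof.
rewrite /prob /hist_mean big_mkcond; apply: eq_bigr => t _ /=.
by case: (P t); rewrite ?mulr1 ?mulr0.
Qed.

Lemma hist_mean1 n m (h : seq (step n l)) : (0 < n)%N -> hist_mean r m h (fun=> 1) = 1.
Proof.
move=> n0; elim: m h => [|m IH] h; first by rewrite hist_mean0.
rewrite hist_meanS -[RHS](step_mean_const hvalid n0 h).
by apply: eq_bigr => s _; rewrite IH.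
Qed.

Lemma hist_meanD n m (h : seq (step n l)) F G :
  hist_mean r m h (fun h => F h + G h) = hist_mean r m h F + hist_mean r m h G.
Proof. by rewrite /hist_mean -big_split; apply: eq_bigr => t _; rewrite mulrDr. Qed.

Lemma hist_meanZ n m (h : seq (step n l)) a F :
  hist_mean r m h (fun h => a * F h) = a * hist_mean r m h F.
Proof. by rewrite /hist_mean mulr_sumr; apply: eq_bigr => t _; rewrite mulrCA. Qed.

Lemma hist_mean_sum n m (h : seq (step n l)) (I : Type) (t : seq I) (P : pred I) F :
  hist_mean r m h (fun h => \sum_(i <- t | P i) F i h) =
  \sum_(i <- t | P i) hist_mean r m h (F i).
Proof.
by rewrite /hist_mean exchange_big; apply: eq_bigr => q _; rewrite mulr_sumr.
Qed.

Lemma hist_mean_le n m F G : (forall h : seq (step n l), size h = m -> 0 < weight r h -> F h <= G h) ->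
  hist_mean r m [::] F <= hist_mean r m [::] G.
Proof.
move=> FG; apply: ler_sum => t _; have := hw_ge0 hvalid [::] t.
rewrite le_eqVlt => /orP[/eqP <-|w0]; first by rewrite !mul0r.
by rewrite ler_pM2l // FG // size_tuple.
Qed.

Lemma mart_energy_ge n (f : seq (step n l) -> R) h m :
  (m <= size h)%N -> mart r f (take m h) ^+ 4 <= mart_energy r f h.
Proof.
move=> mh; have mh' : (m < (size h).+1)%N by [].
have sq (x : R) : 0 <= x ^+ 4 by rewrite (_ : x ^+ 4 = (x ^+ 2) ^+ 2) ?sqr_ge0 // -exprM.
rewrite /mart_energy (bigD1 (Ordinal mh')) //= lerDl.
exact: sumr_ge0.
Qed.

Lemma mart_energy_nil n (f : seq (step n l) -> R) A m :
  (0 < n)%N -> (forall h s, `|f (rcons h s) - f h| <= A) ->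
  hist_mean r m [::] (mart_energy r f) <= 8 * (2 * A) ^+ 4 * m%:R ^+ 3.
Proof.
move=> n0 fA; apply: le_trans (mart_energy_mean hvalid n0 fA m [::]) _.
rewrite /mart_energy big_ord1 /= mart_nil le_eqVlt; apply/orP; left; apply/eqP; ring.
Qed.

(** The index [i] fixes both the precision and the range of sizes [k], so every fixed size is
    eventually covered. Positive weight is required because [drift] speaks only of such
    histories. *)
Definition typical n i (h : seq (step n l)) :=
  [/\ 0 < weight r h,
      (L1 h)%:R <= n%:R / i.+1%:R :> R,
      (forall k m, (k <= i)%N -> (m <= size h)%N ->
         `|mart r (fun h => (Ncount h k)%:R) (take m h)| <= n%:R / i.+1%:R) &
      (forall k m, (k <= i)%N -> (m <= size h)%N ->
         `|mart r (potential R k) (take m h)| <= n%:R / i.+1%:R)].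

(** By assumption [L1] is small with probability above [eps] for arbitrarily large [n], while
    Markov's inequality bounds by [eps] the probability that some martingale part is large. So some
    history avoids both failures. *)
Lemma typical_exists (T eps : R) : 0 <= T -> 0 < eps ->
  (forall alpha : R, 0 < alpha -> forall n0, (0 < n0)%N -> exists2 n, (n0 <= n)%N &
     prob r n (Num.truncn (T * n%:R)) (fun h => alpha * n%:R <= (L1 h)%:R) < 1 - eps) ->
  forall i, exists n (h : seq (step n l)),
    [/\ (i < n)%N, size h = Num.truncn (T * n%:R) & typical i h].
Proof.
move=> T0 e0 neg i.
set a : R := i.+1%:R^-1; have a0 : 0 < a by rewrite invr_gt0.
(* Two families of [i.+1] martingales, all with increments of [f] bounded by [l * i.+1], enter the
   energy bound. *)
set K : R := 2 * i.+1%:R * (8 * (2 * (l * i.+1)%:R) ^+ 4).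
have p4 (x : R) : 0 <= x ^+ 4 by rewrite (_ : x ^+ 4 = (x ^+ 2) ^+ 2) ?sqr_ge0 // -exprM.
have K0 : 0 <= K by rewrite !mulr_ge0.
(* For [n] above this value, [K * (T * n) ^+ 3 <= eps * (a * n) ^+ 4]. *)
set bound := K * T ^+ 3 / (a ^+ 4 * eps).
have [n nn0 pn] := neg a a0 (maxn i.+1 (Num.truncn bound).+1) (leq_trans (ltn0Sn i) (leq_maxl _ _)).
have ni : (i < n)%N by apply: leq_trans nn0; exact: leq_maxl.
have n0 : (0 < n)%N by exact: leq_ltn_trans ni.
have nb : bound < n%:R.
  apply: lt_le_trans (truncnS_gt _) _; rewrite ler_nat.
  by apply: leq_trans nn0; exact: leq_maxr.
exists n; apply: contrapT => none.
set m := Num.truncn (T * n%:R) in pn none *.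
pose energy (h : seq (step n l)) : R := \sum_(k < i.+1)
  (mart_energy r (fun h => (Ncount h k)%:R) h + mart_energy r (potential R k) h).
(* If no typical history exists, each history of positive weight has large [L1] or large energy.
   Taking means yields [1 < (1 - eps) + eps]. *)
have big_energy h : size h = m -> 0 < weight r h ->
    1 <= ((a * n%:R <= (L1 h)%:R)%R)%:R + (a * n%:R) ^- 4 * energy h.
  move=> hm h0; have an0 : 0 < a * n%:R by rewrite mulr_gt0 // ltr0n.
  have E0 : 0 <= energy h.
    by apply: sumr_ge0 => k _; apply: addr_ge0; apply: sumr_ge0.
  have X0 : 0 <= (a * n%:R) ^- 4 * energy h by rewrite mulr_ge0 // invr_ge0 ltW // exprn_gt0.
  case: (lerP (a * n%:R) (L1 h)%:R) => [_|L]; first by rewrite ler_wpDr.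
  rewrite add0r leNgt; apply/negP => small.
  have {}small : energy h < (a * n%:R) ^+ 4.
    by move: small; rewrite mulrC ltr_pdivrMr ?exprn_gt0 // mul1r.
  have bnd x : x ^+ 4 <= energy h -> `|x| <= n%:R / i.+1%:R.
    move=> xe; rewrite mulrC leNgt; apply/negP => ax.
    have := le_lt_trans xe small; rewrite ltNge => /negP; apply.
    rewrite -[x ^+ 4]ger0_norm // normrX lerXn2r // ?nnegrE //; exact: ltW.
  apply: none; exists h; split => //; split => //.
  - by rewrite mulrC ltW.
  - move=> k j ki jh; apply: bnd; apply: le_trans (mart_energy_ge _ jh) _.
    rewrite /energy (bigD1 (Ordinal (ki : (k < i.+1)%N))) //= -addrA lerDl.
    by apply: addr_ge0; [|apply: sumr_ge0 => q _; apply: addr_ge0]; apply: sumr_ge0.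
  - move=> k j ki jh; apply: bnd; apply: le_trans (mart_energy_ge _ jh) _.
    rewrite /energy (bigD1 (Ordinal (ki : (k < i.+1)%N))) //= addrAC lerDr.
    by apply: addr_ge0; [|apply: sumr_ge0 => q _; apply: addr_ge0]; apply: sumr_ge0.
have E : hist_mean r m [::] energy <= K * m%:R ^+ 3.
  rewrite hist_mean_sum.
  apply: le_trans (_ : \sum_(k < i.+1) 2 * (8 * (2 * (l * i.+1)%:R) ^+ 4 * m%:R ^+ 3) <= _).
    apply: ler_sum => k _; rewrite hist_meanD mulr_natl mulr2n.
    have m3 : 0 <= m%:R ^+ 3 :> R by rewrite exprn_ge0.
    apply: lerD.
      apply: mart_energy_nil => // h s; apply: le_trans (Ncount_lip R k h s) _.
      by rewrite ler_nat leq_mul2l orbC ltnW // ltn_ord.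
    apply: mart_energy_nil => // h s; apply: le_trans (potential_lip R k h s) _.
    by rewrite ler_nat leq_pmulr.
  by rewrite sumr_const card_ord -mulr_natl le_eqVlt; apply/orP; left; apply/eqP; rewrite /K; ring.
have := hist_mean_le big_energy.
rewrite hist_mean1 // hist_meanD hist_meanZ -prob_hist_mean.
have an4 : 0 < (a * n%:R) ^+ 4 by rewrite exprn_gt0 // mulr_gt0 // ltr0n.
have mT : m%:R <= T * n%:R by rewrite truncn_le // mulr_ge0.
suff : (a * n%:R) ^- 4 * hist_mean r m [::] energy <= eps by move: pn; lra.
rewrite mulrC ler_pdivrMr //; apply: le_trans E _.
apply: le_trans (_ : K * (T * n%:R) ^+ 3 <= _).
  by rewrite ler_wpM2l // lerXn2r ?nnegrE // mulr_ge0.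
move: nb; rewrite /bound ltr_pdivrMr ?mulr_gt0 ?exprn_gt0 // => /ltW nb.
have n3 : 0 <= n%:R ^+ 3 :> R by rewrite exprn_ge0.
have := ler_wpM2r n3 nb; rewrite -subr_ge0 => H; rewrite -subr_ge0.
apply: le_trans H _; rewrite le_eqVlt; apply/orP; left; apply/eqP; ring.
Qed.

End Selection.

(** * Increments along a typical history *)

Section Products.
Variable R : realType.

(** Factors are replaced one at a time; the others lie in [0, 1] and do not amplify the
    difference. *)
Lemma prod_lip (I : Type) (t : seq I) (a b : I -> R) :
  (forall i, 0 <= a i <= 1) -> (forall i, 0 <= b i <= 1) ->
  `|\prod_(i <- t) a i - \prod_(i <- t) b i| <= \sum_(i <- t) `|a i - b i|.
Proof.
move=> a01 b01; elim: t => [|i t IH]; first by rewrite !big_nil subrr normr0.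
rewrite !big_cons.
have -> : forall A B : R, a i * A - b i * B = a i * (A - B) + (a i - b i) * B by move=> *; ring.
apply: le_trans (ler_normD _ _) _; rewrite addrC; apply: lerD.
  rewrite normrM ler_piMr // ger0_norm ?prodr_ge0 // => [|j _]; last by case/andP: (b01 j).
  by apply: prodr_ile1.
rewrite normrM (le_trans _ IH) // ler_piMl //.
by case/andP: (a01 i) => a0 a1; rewrite ger0_norm.
Qed.

Lemma box_lip (l B : nat) (D e : R) (F : ('I_l -> nat) -> R) (X Y : nat -> R) :
  (forall c, `|F c| <= D) -> (forall k, 0 <= X k <= 1) -> (forall k, 0 <= Y k <= 1) ->
  (forall k, (k <= B)%N -> `|X k - Y k| <= e) ->
  `|box_sum (fun c => F c * \prod_(j < l) X (c j)) B
    - box_sum (fun c => F c * \prod_(j < l) Y (c j)) B| <= (B ^ l)%:R * (D * (l%:R * e)).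
Proof.
move=> FD X01 Y01 XY; rewrite /box_sum -sumrB.
apply: le_trans (ler_norm_sum _ _ _) _.
apply: le_trans (_ : \sum_(c : {ffun 'I_l -> 'I_B}) D * (l%:R * e) <= _); last first.
  by rewrite sumr_const card_ffun !card_ord -[X in X <= _]mulr_natl.
apply: ler_sum => c _; rewrite -mulrBr normrM.
apply: ler_pM => //; apply: le_trans (prod_lip _ _ _) _ => //.
apply: le_trans (_ : \sum_(j < l) e <= _); last by rewrite sumr_const card_ord mulr_natl.
by apply: ler_sum => j _; apply: XY.
Qed.

Lemma box_sum_prod (l B : nat) (X : nat -> R) :
  box_sum (fun c => \prod_(j < l) X (c j)) B = (\sum_(1 <= k < B.+1) X k) ^+ l.
Proof.
rewrite /box_sum big_add1 /= big_mkord -(bigA_distr_bigA (fun (_ : 'I_l) (x : 'I_B) => X x.+1)).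
by rewrite prodr_const card_ord.
Qed.

Lemma box_sum_mono (l B N : nat) (G : ('I_l -> nat) -> R) :
  (forall c : 'I_l -> nat, 0 <= G c) -> (B <= N)%N -> box_sum G B <= box_sum G N.
Proof.
move=> G0 BN; pose w (c : {ffun 'I_l -> 'I_B}) := [ffun j => widen_ord BN (c j)].
have w_inj : injective w.
  move=> c1 c2 /ffunP e; apply/ffunP => j; have := e j; rewrite !ffunE => /(congr1 val) /=.
  exact: val_inj.
rewrite /box_sum [X in _ <= X](bigID (mem (w @: [set: {ffun 'I_l -> 'I_B}]%SET))) /=.
rewrite big_imset /=; last by move=> c1 c2 _ _; apply: w_inj.
apply: ler_wpDr; first by apply: sumr_ge0.
rewrite le_eqVlt; apply/orP; left; apply/eqP; apply: eq_big => c; rewrite ?inE //.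
by move=> _; congr G; apply/funext => j; rewrite ffunE.
Qed.

End Products.

Section Increments.
Variables (R : realType) (l : nat) (r : rule R l) (d : nat -> ('I_l -> nat) -> R).
Hypotheses (hvalid : valid_rule r) (hdrift : drift r d).
Variables (n i : nat) (h : seq (step n l)).
Hypotheses (i_lt_n : (i < n)%N) (typ : typical r i h).

Let n_gt0 : (0 < n)%N. Proof. exact: leq_ltn_trans i_lt_n. Qed.
Let nR_gt0 : 0 < n%:R :> R. Proof. by rewrite ltr0n n_gt0. Qed.
Let nV_ge0 : 0 <= n%:R^-1 :> R. Proof. by rewrite invr_ge0. Qed.

Definition density k m : R := (Ncount (take m h) k)%:R / n%:R.
Definition below k m : R := (Nlt (take m h) k)%:R / n%:R.
Definition pot k m : R := potential R k (take m h) / n%:R.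
Local Notation err := (i.+1%:R^-1 : R).

Lemma mart_increment f m1 m2 : (m1 <= m2 <= size h)%N ->
  f (take m2 h) - f (take m1 h) =
  mart r f (take m2 h) - mart r f (take m1 h) + \sum_(m1 <= m < m2) drift_of r f (take m h).
Proof.
move=> /andP[m12 m2h].
have E m : (m <= size h)%N -> mart r f (take m h) =
    f (take m h) - f [::] - \sum_(0 <= j < m) drift_of r f (take j h).
  move=> mh; rewrite /mart size_takel // big_mkord; congr (_ - _).
  by apply: eq_bigr => j _; rewrite take_takel // ltnW.
rewrite !E // ?(leq_trans m12) // (big_cat_nat _ m12) //=; ring.
Qed.

Lemma increment_bound f m1 m2 (lo hi : R) : (m1 <= m2 <= size h)%N ->
  (forall m, (m <= size h)%N -> `|mart r f (take m h)| <= n%:R / i.+1%:R) ->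
  (forall m, (m1 <= m < m2)%N -> lo <= drift_of r f (take m h) <= hi) ->
  (m2 - m1)%:R / n%:R * lo - 2 * err <= f (take m2 h) / n%:R - f (take m1 h) / n%:R
    <= (m2 - m1)%:R / n%:R * hi + 2 * err.
Proof.
move=> m12h small bnd; have /andP[m12 m2h] := m12h.
rewrite -mulrBl mart_increment //.
have S_lo : (m2 - m1)%:R * lo <= \sum_(m1 <= m < m2) drift_of r f (take m h).
  rewrite mulr_natl -sumr_const_nat !big_nat; apply: ler_sum => m /bnd; by case/andP.
have S_hi : \sum_(m1 <= m < m2) drift_of r f (take m h) <= (m2 - m1)%:R * hi.
  rewrite mulr_natl -sumr_const_nat !big_nat; apply: ler_sum => m /bnd; by case/andP.
have M_le : `|(mart r f (take m2 h) - mart r f (take m1 h)) / n%:R| <= 2 * err.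
  rewrite normrM (ger0_norm nV_ge0) ler_pdivrMr //.
  apply: le_trans (ler_normB _ _) _.
  rewrite (_ : 2 * err * n%:R = n%:R / i.+1%:R + n%:R / i.+1%:R); last by ring.
  by rewrite lerD // small // (leq_trans m12).
have := ler_wpM2r nV_ge0 S_lo; have := ler_wpM2r nV_ge0 S_hi.
move: M_le; rewrite ler_norml => /andP[].
rewrite -!(mulrAC _ _ n%:R^-1); move: (\sum_(_ <= _ < _) _) (_ - mart _ _ _) (n%:R^-1).
move: (_ - _)%:R (i.+1%:R^-1) => D e S M w *; rewrite mulrDl.
by apply/andP; split; lra.
Qed.

Lemma below_take_le k m1 m2 : (m1 <= m2)%N -> below k m2 <= below k m1.
Proof.
move=> m12; rewrite ler_wpM2r // ler_nat -(take_takel h m12); exact: Nlt_take.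
Qed.

Lemma below_itv k m : 0 <= below k m <= 1.
Proof. by rewrite divr_ge0 //= ler_pdivrMr // mul1r ler_nat Nlt_le. Qed.

Lemma density_itv k m : 0 <= density k m <= 1.
Proof. by rewrite divr_ge0 //= ler_pdivrMr // mul1r ler_nat Ncount_le. Qed.

Lemma below_sum k m : below k m = \sum_(1 <= j < k) density j m.
Proof. by rewrite /below -sum_Ncount natr_sum mulr_suml. Qed.

Lemma take_lip (f : seq (step n l) -> R) A m1 m2 : (m1 <= m2 <= size h)%N ->
  (forall g s, f g <= f (rcons g s) + A) -> f (take m1 h) <= f (take m2 h) + (m2 - m1)%:R * A.
Proof.
move=> /andP[m12 m2h] fA; elim: m2 m12 m2h => [|m2 IH].
  by rewrite leqn0 => /eqP ->; rewrite subnn mul0r addr0.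
rewrite leq_eqVlt => /orP[/eqP ->|]; first by rewrite subnn mul0r addr0.
rewrite ltnS => m12 m2h; apply: le_trans (IH m12 (ltnW m2h)) _.
(* Since [m2 < size h], the history is nonempty and the type of steps is inhabited. *)
have [s0] : exists s0 : step n l, True by case: (h) m2h => // s ? _; exists s.
move=> _; rewrite subSn // -natr1 mulrDl mul1r.
have := fA (take m2 h) (nth s0 h m2); rewrite -take_nth //.
by move: (_ * A) => D H; lra.
Qed.

Lemma below_lip k m1 m2 : (m1 <= m2 <= size h)%N ->
  below k m1 <= below k m2 + (m2 - m1)%:R / n%:R * (l * k)%:R.
Proof.
move=> m12; have fA g (s : step n l) : (Nlt g k)%:R <= (Nlt (rcons g s) k)%:R + (l * k)%:R :> R.
  by rewrite -natrD ler_nat Nlt_rcons_ge.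
have := ler_wpM2r nV_ge0 (take_lip m12 fA).
by rewrite mulrDl -mulrAC.
Qed.

Lemma density_lip k m1 m2 : (m1 <= m2 <= size h)%N ->
  `|density k m2 - density k m1| <= (m2 - m1)%:R / n%:R * (l * k)%:R.
Proof.
move=> m12; have fA g (s : step n l) := Ncount_lip R k g s.
have f1 (g : seq (step n l)) s : (Ncount g k)%:R <= (Ncount (rcons g s) k)%:R + (l * k)%:R :> R.
  by have := fA g s; rewrite ler_norml => /andP[*]; lra.
have f2 (g : seq (step n l)) s : - (Ncount g k)%:R <= - (Ncount (rcons g s) k)%:R + (l * k)%:R :> R.
  by have := fA g s; rewrite ler_norml => /andP[*]; lra.
have := ler_wpM2r nV_ge0 (take_lip m12 f1).
have := ler_wpM2r nV_ge0 (@take_lip (fun g => - (Ncount g k)%:R) _ _ _ m12 f2).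
rewrite !mulrDl !mulNr -!(mulrAC _ _ n%:R^-1) -/(density k m1) -/(density k m2).
move: ((m2 - m1)%:R * (l * k)%:R / n%:R) => D H1 H2; rewrite ler_norml; apply/andP; split; lra.
Qed.

Lemma L1_small m : (L1 (take m h))%:R / n%:R <= err.
Proof.
rewrite ler_pdivrMr // mulrC; case: typ => _ L _ _; apply: le_trans L.
by rewrite ler_nat L1_take.
Qed.

(** Mass in components of size at least [k] only grows, so the drift bound at time [m1] holds
    throughout the interval. *)
Lemma pot_decrease k m1 m2 : (m1 <= m2 <= size h)%N -> (k <= i)%N ->
  pot k m2 - pot k m1 <=
    (m2 - m1)%:R / n%:R * (- (1 - below k m1) ^+ l + (l ^ 2)%:R * err) + 2 * err.
Proof.
move=> m12 ki; case: (typ) => w0 _ _ sm.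
have bnd m : (m1 <= m < m2)%N -> - l%:R <= Xdrift r k (take m h)
    <= - (1 - below k m1) ^+ l + (l ^ 2)%:R * err.
  move=> /andP[m1m mm2]; apply/andP; split.
    have := drift_of_le hvalid n_gt0 (potential_lip R k) (take m h).
    by rewrite ler_norml => /andP[].
  apply: le_trans (Xdrift_le hvalid n_gt0 k _) _; apply: lerD; last first.
    by rewrite ler_wpM2l // L1_small.
  have le_m := below_take_le k m1m; have /andP[_ b1] := below_itv k m1.
  have /andP[_ b2] := below_itv k m.
  by rewrite lerN2 -/(below k m); apply: lerXn2r; rewrite ?nnegrE ?subr_ge0 // lerD2l lerN2.
by have /andP[] := increment_bound m12 (fun m mh => sm k m ki mh) bnd.
Qed.

(** The loss rate involves the current density, which is replaced by its initial value plus a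
    Lipschitz error. That error is quadratic in [D] and disappears under subdivision of the time
    interval. *)
Lemma density_ge k m1 m2 D : (m1 <= m2 <= size h)%N -> (k <= i)%N ->
  D = (m2 - m1)%:R / n%:R ->
  density k m1 - D * ((l * k)%:R * (density k m1 + D * (l * k)%:R)) - 2 * err <= density k m2.
Proof.
move=> m12 ki DE; case: (typ) => w0 _ sm _; have /andP[_ m2h] := m12.
have bnd m : (m1 <= m < m2)%N -> - ((l * k)%:R * (density k m1 + D * (l * k)%:R))
    <= Ndrift r k (take m h) <= (l * k)%:R.
  move=> /andP[m1m mm2]; apply/andP; split; last first.
    have := drift_of_le hvalid n_gt0 (Ncount_lip R k) (take m h).
    by rewrite ler_norml => /andP[].
  apply: le_trans (Ndrift_ge hvalid n_gt0 k _); rewrite lerN2 ler_wpM2l //.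
  have m1mh : (m1 <= m <= size h)%N by rewrite m1m (leq_trans (ltnW mm2)).
  have := density_lip k m1mh; rewrite ler_norml => /andP[_].
  rewrite -/(density k m) lerBlDl => /le_trans; apply; rewrite lerD2l ler_wpM2r //.
  by rewrite DE ler_wpM2r // ler_nat leq_sub2r // ltnW.
have /andP[+ _] := increment_bound m12 (fun m mh => sm k m ki mh) bnd.
rewrite -DE -/(density k m1) -/(density k m2) mulrN.
set P := D * ((l * k)%:R * (density k m1 + D * (l * k)%:R)).
by move: P (density k m1) (density k m2) (i.+1%:R^-1) => P a b e *; lra.
Qed.

Definition box_rate k B (X : nat -> R) : R :=
  box_sum (fun c => clip d k c * \prod_(j < l) X (c j)) B.

(** The reference time [m] is free inside the interval, so that left and right difference quotients
    can both be treated. The tail is taken at [m2], where it is largest. *)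
Lemma density_increment k B m1 m m2 D : (m1 <= m <= m2)%N -> (m2 <= size h)%N ->
  (0 < k <= i)%N -> D = (m2 - m1)%:R / n%:R ->
  `|density k m2 - density k m1 - D * box_rate k B (density ^~ m)| <=
    D * ((l * k)%:R * (2 * (l ^ 2)%:R * err + l%:R * (1 - below B.+1 m2))
         + (B ^ l)%:R * ((l * k)%:R * (l%:R * (D * (l * B)%:R)))) + 2 * err.
Proof.
move=> /andP[m1m mm2] m2h /andP[k0 ki] DE; case: (typ) => w0 _ sm _.
set P1 := (l * k)%:R * (_ + _); set P2 := (B ^ l)%:R * _; set E := P1 + P2; set S := box_rate k B _.
have m12 : (m1 <= m2 <= size h)%N by rewrite (leq_trans m1m).
have lip c a b : (c <= B)%N -> (m1 <= a)%N -> (a <= b)%N -> (b <= m2)%N ->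
    `|density c b - density c a| <= D * (l * B)%:R.
  move=> cB m1a ab bm2.
  apply: le_trans (_ : (b - a)%:R / n%:R * (l * c)%:R <= _).
    by apply: density_lip; rewrite ab (leq_trans bm2).
  rewrite DE; apply: ler_pM; rewrite ?mulr_ge0 //; last by rewrite ler_nat leq_mul2l cB orbT.
  by rewrite ler_wpM2r // ler_nat leq_sub.
have bnd q : (m1 <= q < m2)%N -> S - E <= Ndrift r k (take q h) <= S + E.
  move=> /andP[m1q /ltnW qm2].
  have H1 := Ndrift_box hvalid hdrift B n_gt0 (weight_take_gt0 hvalid q w0) k0.
  have H2 : `|box_rate k B (density ^~ q) - S| <= P2.
    apply: box_lip => [c|c|c|c cB]; [exact: clip_le|exact: density_itv|exact: density_itv|].
    by case: (leqP q m) => [qm|/ltnW mq]; [rewrite distrC|]; apply: lip.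
  have H3 : (l * k)%:R * (2 * (l ^ 2)%:R * ((L1 (take q h))%:R / n%:R)
       + l%:R * (1 - (Nlt (take q h) B.+1)%:R / n%:R)) <= P1.
    rewrite ler_wpM2l // lerD // ler_wpM2l ?mulr_ge0 // ?L1_small // lerD2l lerN2.
    exact: below_take_le.
  have := le_trans H1 H3; move: H2; rewrite !ler_norml /E.
  rewrite -/(box_rate k B (density ^~ q)).
  clear E H1 H3; move: (box_rate k B _) (Ndrift _ _ _) S P1 P2 => a b c x y.
  by move=> /andP[? ?] /andP[? ?]; apply/andP; split; lra.
have := increment_bound m12 (fun m mh => sm k m ki mh) bnd.
rewrite -DE -/(density k m1) -/(density k m2) mulrBr [D * (S + E)]mulrDr.
clearbody E; move: (D * S) (D * E) (density k m1) (density k m2) (i.+1%:R^-1) => a b x y e /andP[? ?].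
by rewrite ler_norml; apply/andP; split; lra.
Qed.

Lemma pot_le k b m : (0 < k)%N -> (0 < b)%N -> pot k m <= below b m / k%:R + b%:R^-1.
Proof.
move=> k0 b0; rewrite /pot ler_pdivrMr //.
apply: le_trans (potential_le R (take m h) k0 b0) _.
by rewrite mulrDl /below mulrAC divfK ?gt_eqF // [n%:R / _]mulrC.
Qed.

Lemma pot_ge k a m : (a <= k)%N -> below a m / k%:R <= pot k m.
Proof.
move=> ak; rewrite /pot /below mulrAC ler_wpM2r //; exact: potential_ge.
Qed.

(** If the sizes [c] are drawn with probability exceeding that of a bad tuple, some tuple in
    distinct components realises them, and [d k c] is a genuine conditional drift. *)
Lemma clip_realised k (c : 'I_l -> nat) m : (0 < k)%N ->
  (l ^ 2)%:R * err < \prod_(j < l) density (c j) m -> d k c = clip d k c.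
Proof.
move=> k0 big; set g := take m h.
have g0 : 0 < weight r g by apply: weight_take_gt0 => //; case: typ.
have E : \prod_(j < l) density (c j) m =
    tuple_mean (fun v => \prod_(j < l) (#|cc g (v j)| == c j)%:R).
  rewrite (tuple_mean_prod (fun j x => (#|cc g x| == c j)%:R)).
  by apply: eq_bigr => j _; rewrite -sum_Ncount_eq.
have [v [dist vc]] : exists v, distinct_comps g v /\ (forall j, #|cc g (v j)| = c j).
  apply: contrapT => none; move: big; rewrite E ltNge => /negP; apply.
  apply: le_trans (_ : tuple_mean (bad_tuple R g) <= _); last first.
    apply: le_trans (bad_tuple_mean R n_gt0 g) _; rewrite ler_wpM2l //; exact: L1_small.
  apply: tuple_mean_le => v; rewrite /bad_tuple; case: asboolP => /= dist.
    have [all|/existsNP[j /eqP]] := pselect (forall j, #|cc g (v j)| = c j).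
      by case: none; exists v.
    by move=> /negbTE vj; rewrite (bigD1 j) //= vj mul0r.
  apply: prodr_ile1 => j _; by case: eqP; rewrite ?lexx ?ler01.
have -> : c = (fun j => #|cc g (v j)|) by apply/funext => j; rewrite vc.
exact: drift_clip.
Qed.

End Increments.

(** * Ultralimits *)

Section UltraLimit.
Variables (R : realType) (U : set_system nat).
Hypothesis (UU : UltraFilter U).

(** By compactness the image ultrafilter has a cluster point, and an ultrafilter converges to each
    of its cluster points. *)
Lemma ultra_cvg (f : nat -> R) a b : (forall i, a <= f i <= b) -> cvg (f @ U).
Proof.
move=> fab; have Uab : U (f @^-1` [set` `[a, b]]).
  by apply: filterE => i; rewrite /= in_itv /=; exact: fab.
have [p [_ pcl]] : [set` `[a, b]] `&` cluster (f @ U) !=set0 by exact: segment_compact.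
apply: (cvgP p) => B pB.
have [//|UnB] := in_ultra_setVsetC (f @^-1` B) UU.
have : (f @ U) (~` B) by [].
by move=> /(pcl (~` B) B) /(_ pB) [q []].
Qed.

Lemma cvg_bigsum (I : Type) (s : seq I) (f : I -> nat -> R) (L : I -> R) :
  (forall j, f j @ U --> L j) -> (fun i => \sum_(j <- s) f j i) @ U --> \sum_(j <- s) L j.
Proof.
move=> fL; elim: s => [|j s IH].
  by under eq_fun do rewrite big_nil; rewrite big_nil; exact: cvg_cst.
by under eq_fun do rewrite big_cons; rewrite big_cons; exact: cvgD.
Qed.

Lemma cvg_bigprod (I : Type) (s : seq I) (f : I -> nat -> R) (L : I -> R) :
  (forall j, f j @ U --> L j) -> (fun i => \prod_(j <- s) f j i) @ U --> \prod_(j <- s) L j.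
Proof.
move=> fL; elim: s => [|j s IH].
  by under eq_fun do rewrite big_nil; rewrite big_nil; exact: cvg_cst.
by under eq_fun do rewrite big_cons; rewrite big_cons; exact: cvgM.
Qed.

Lemma cvg_pow (f : nat -> R) (L : R) m : f @ U --> L -> (fun i => f i ^+ m) @ U --> L ^+ m.
Proof.
move=> fL; elim: m => [|m IH]; first by under eq_fun do rewrite expr0; exact: cvg_cst.
by under eq_fun do rewrite exprS; rewrite exprS; exact: cvgM.
Qed.

End UltraLimit.

(** * Limits of densities and potentials along typical histories *)

Section Limit.
Variables (R : realType) (l : nat) (r : rule R l) (d : nat -> ('I_l -> nat) -> R).
Hypotheses (hvalid : valid_rule r) (hdrift : drift r d).
Variables (T : R) (n_ : nat -> nat) (h_ : forall i, seq (step (n_ i) l)).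
Hypotheses (i_lt_n : forall i, (i < n_ i)%N)
  (size_h : forall i, size (h_ i) = Num.truncn (T * (n_ i)%:R))
  (typ : forall i, typical r i (h_ i)).
Variable U : set_system nat.
Hypotheses (UU : UltraFilter U) (U_oo : \oo `<=` U).

Let n_gt0 i : (0 < n_ i)%N. Proof. exact: leq_ltn_trans (i_lt_n i). Qed.
Let nR_gt0 i : 0 < (n_ i)%:R :> R. Proof. by rewrite ltr0n n_gt0. Qed.

Definition time_index (t : R) i := Num.truncn (t * (n_ i)%:R).
Local Notation idx := time_index.

Definition lim_density k t : R := lim ((fun i => density R (h_ i) k (idx t i)) @ U).
Definition lim_pot k t : R := lim ((fun i => pot R (h_ i) k (idx t i)) @ U).
Definition mass_below k t : R := \sum_(1 <= j < k) lim_density j t.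

Lemma near_U m : \forall i \near U, (m <= i)%N.
Proof. by apply: U_oo; exists m. Qed.

Lemma err_cvg : (fun i : nat => i.+1%:R^-1 : R) @ U --> 0.
Proof. by move=> B /cvg_harmonic; exact: U_oo. Qed.

Lemma lim_density_cvg k t : (fun i => density R (h_ i) k (idx t i)) @ U --> lim_density k t.
Proof. by apply: (ultra_cvg UU) => i; exact: density_itv. Qed.

Lemma below_cvg k t : (fun i => below R (h_ i) k (idx t i)) @ U --> mass_below k t.
Proof.
under eq_fun do rewrite below_sum; rewrite /mass_below.
by apply: cvg_bigsum => j; exact: lim_density_cvg.
Qed.

Lemma lim_pot_cvg k t : (0 < k)%N -> (fun i => pot R (h_ i) k (idx t i)) @ U --> lim_pot k t.
Proof.
move=> k0; apply: (@ultra_cvg _ _ UU _ 0 2) => i; rewrite divr_ge0 ?potential_ge0 //=.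
apply: le_trans (pot_le R (h_ i) (i_lt_n i) (idx t i) k0 (ltn0Sn 0)) _.
have /andP[b0 b1] := below_itv R (h_ i) (i_lt_n i) 1 (idx t i).
rewrite invr1 -[2]/(1 + 1) lerD2r ler_pdivrMr ?ltr0n // mul1r.
by apply: le_trans b1 _; rewrite ler1n.
Qed.

Lemma idx_le t u i : t <= u -> (idx t i <= idx u i)%N.
Proof. by move=> tu; apply: le_truncn; rewrite ler_wpM2r. Qed.

Lemma idx_size u i : u <= T -> (idx u i <= size (h_ i))%N.
Proof. by rewrite size_h; exact: idx_le. Qed.

(** Rounding times to integers costs at most one step, that is [1 / n_ i], which [i < n_ i] bounds
    by [1 / i.+1]. *)
Lemma elapsed_cvg t u : 0 <= t <= u ->
  (fun i => (idx u i - idx t i)%:R / (n_ i)%:R) @ U --> u - t.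
Proof.
move=> /andP[t0 tu].
have e0 := err_cvg.
apply: (@squeeze_cvgr _ _ _ _ (fun i => u - t - i.+1%:R^-1) (fun i => u - t + i.+1%:R^-1)).
- apply: filterE => i; have n0 := nR_gt0 i.
  have u0 : 0 <= u by exact: le_trans tu.
  have /andP[a1 a2] := truncn_itv (mulr_ge0 t0 (ltW n0)).
  have /andP[b1 b2] := truncn_itv (mulr_ge0 u0 (ltW n0)).
  rewrite natrB ?idx_le // ler_pdivlMr // ler_pdivrMr //.
  have : 1 <= i.+1%:R^-1 * (n_ i)%:R :> R.
    by rewrite mulrC ler_pdivlMr // mul1r ler_nat i_lt_n.
  rewrite !mulrDl !mulNr; move: (i.+1%:R^-1 * _) => e e1.
  move: a1 a2 b1 b2; rewrite -!natr1 -/(idx t i) -/(idx u i).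
  move: (t * _) (u * _) (idx t i)%:R (idx u i)%:R => a b c q *.
  by apply/andP; split; lra.
- by rewrite -[X in _ --> X]subr0; apply: cvgB => //; exact: cvg_cst.
- by rewrite -[X in _ --> X]addr0; apply: cvgD => //; exact: cvg_cst.
Qed.

Lemma lim_density_itv k t : 0 <= lim_density k t <= 1.
Proof.
have c := @lim_density_cvg k t; apply/andP; split.
  apply: (cvgr_to_ge c); apply: filterE => i.
  by case/andP: (density_itv R (h_ i) (i_lt_n i) k (idx t i)).
apply: (cvgr_to_le c); apply: filterE => i.
by case/andP: (density_itv R (h_ i) (i_lt_n i) k (idx t i)).
Qed.

Lemma mass_below_le1 k t : mass_below k t <= 1.
Proof.
apply: (cvgr_to_le (@below_cvg k t)); apply: filterE => i.
by case/andP: (below_itv R (h_ i) (i_lt_n i) k (idx t i)).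
Qed.

Lemma mass_below_decr k t u : t <= u -> mass_below k u <= mass_below k t.
Proof.
move=> tu; apply: (ler_cvg_to (@below_cvg k u) (@below_cvg k t)).
by apply: filterE => i; apply: below_take_le => //; exact: idx_le.
Qed.

Lemma idx_range t u i : t <= u <= T -> (idx t i <= idx u i <= size (h_ i))%N.
Proof. by move=> /andP[tu uT]; rewrite idx_le ?idx_size. Qed.

Lemma mass_below_lip k t u : 0 <= t -> t <= u <= T ->
  mass_below k t <= mass_below k u + (u - t) * (l * k)%:R.
Proof.
move=> t0 tuT; have /andP[tu uT] := tuT.
have H : (fun i => below R (h_ i) k (idx u i) +
    (idx u i - idx t i)%:R / (n_ i)%:R * (l * k)%:R) @ U
    --> mass_below k u + (u - t) * (l * k)%:R.
  apply: cvgD; first exact: below_cvg.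
  by apply: cvgM; [apply: elapsed_cvg; rewrite t0|exact: cvg_cst].
apply: (ler_cvg_to (@below_cvg k t) H); apply: filterE => i.
by apply: below_lip => //; exact: idx_range.
Qed.

Lemma lim_pot_decrease k t u : (0 < k)%N -> 0 <= t -> t <= u <= T ->
  lim_pot k u - lim_pot k t <= (u - t) * - (1 - mass_below k t) ^+ l.
Proof.
move=> k0 t0 tuT; have /andP[tu uT] := tuT.
have H : (fun i => (idx u i - idx t i)%:R / (n_ i)%:R *
      (- (1 - below R (h_ i) k (idx t i)) ^+ l + (l ^ 2)%:R * i.+1%:R^-1) + 2 * i.+1%:R^-1) @ U
    --> (u - t) * (- (1 - mass_below k t) ^+ l + (l ^ 2)%:R * 0) + 2 * 0.
  apply: cvgD; last by apply: cvgM; [exact: cvg_cst|exact: err_cvg].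
  apply: cvgM; first by apply: elapsed_cvg; rewrite t0.
  apply: cvgD; last by apply: cvgM; [exact: cvg_cst|exact: err_cvg].
  apply: cvgN; apply: cvg_pow; apply: cvgB; [exact: cvg_cst|exact: below_cvg].
move: H; rewrite !mulr0 !addr0 => H.
apply: (ler_cvg_to (cvgB (@lim_pot_cvg k u k0) (@lim_pot_cvg k t k0)) H).
near=> i; apply: (pot_decrease hvalid) => //; first exact: idx_range.
near: i; exact: near_U.
Unshelve. all: end_near. Qed.

Lemma lim_pot_le k b t : (0 < k)%N -> (0 < b)%N -> lim_pot k t <= mass_below b t / k%:R + b%:R^-1.
Proof.
move=> k0 b0.
have H : (fun i => below R (h_ i) b (idx t i) / k%:R + b%:R^-1) @ U
    --> mass_below b t / k%:R + b%:R^-1.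
  by apply: cvgD; [apply: cvgM; [exact: below_cvg|exact: cvg_cst]|exact: cvg_cst].
by apply: (ler_cvg_to (@lim_pot_cvg k t k0) H); apply: filterE => i; apply: (pot_le R (h_ i) (i_lt_n i)).
Qed.

Lemma lim_pot_ge k a t : (0 < k)%N -> (a <= k)%N -> mass_below a t / k%:R <= lim_pot k t.
Proof.
move=> k0 ak.
have H : (fun i => below R (h_ i) a (idx t i) / k%:R) @ U --> mass_below a t / k%:R.
  by apply: cvgM; [exact: below_cvg|exact: cvg_cst].
by apply: (ler_cvg_to H (@lim_pot_cvg k t k0)); apply: filterE => i; apply: pot_ge.
Qed.

Lemma lim_density_ge k t u : 0 <= t -> t <= u <= T ->
  lim_density k t - (u - t) * ((l * k)%:R * (lim_density k t + (u - t) * (l * k)%:R)) <= lim_density k u.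
Proof.
move=> t0 tuT; have /andP[tu uT] := tuT.
pose D i : R := (idx u i - idx t i)%:R / (n_ i)%:R.
have HD : D @ U --> u - t by apply: elapsed_cvg; rewrite t0.
have H : (fun i => density R (h_ i) k (idx t i) -
    D i * ((l * k)%:R * (density R (h_ i) k (idx t i) + D i * (l * k)%:R)) - 2 * i.+1%:R^-1) @ U
    --> lim_density k t - (u - t) * ((l * k)%:R * (lim_density k t + (u - t) * (l * k)%:R)) - 2 * 0.
  apply: cvgB; last by apply: cvgM; [exact: cvg_cst|exact: err_cvg].
  apply: cvgB; first exact: lim_density_cvg.
  apply: cvgM => //; apply: cvgM; first exact: cvg_cst.
  apply: cvgD; first exact: lim_density_cvg.
  by apply: cvgM => //; exact: cvg_cst.
move: H; rewrite mulr0 subr0 => H; apply: (ler_cvg_to H (@lim_density_cvg k u)).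
near=> i; apply: (density_ge hvalid) => //; first exact: idx_range.
near: i; exact: near_U.
Unshelve. all: end_near. Qed.

Lemma box_rate_cvg k B t : (fun i => box_rate d k B (fun c => density R (h_ i) c (idx t i))) @ U
  --> box_rate d k B (lim_density ^~ t).
Proof.
rewrite /box_rate /box_sum; apply: cvg_bigsum => c.
apply: cvgM; first exact: cvg_cst.
by apply: cvg_bigprod => j; exact: lim_density_cvg.
Qed.

Lemma lim_density_increment k B t w u : (0 < k)%N -> 0 <= t -> t <= w <= u -> u <= T ->
  `|lim_density k u - lim_density k t - (u - t) * box_rate d k B (lim_density ^~ w)| <=
  (u - t) * ((l * k)%:R * (l%:R * (1 - mass_below B.+1 u))
     + (B ^ l)%:R * ((l * k)%:R * (l%:R * ((u - t) * (l * B)%:R)))).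
Proof.
move=> k0 t0 /andP[tw wu] uT.
have tu : t <= u by exact: le_trans wu.
pose D i : R := (idx u i - idx t i)%:R / (n_ i)%:R.
have HD : D @ U --> u - t by apply: elapsed_cvg; rewrite t0.
have H : (fun i => D i * ((l * k)%:R * (2 * (l ^ 2)%:R * i.+1%:R^-1 +
      l%:R * (1 - below R (h_ i) B.+1 (idx u i)))
     + (B ^ l)%:R * ((l * k)%:R * (l%:R * (D i * (l * B)%:R)))) + 2 * i.+1%:R^-1) @ U -->
   (u - t) * ((l * k)%:R * (2 * (l ^ 2)%:R * 0 + l%:R * (1 - mass_below B.+1 u))
     + (B ^ l)%:R * ((l * k)%:R * (l%:R * ((u - t) * (l * B)%:R)))) + 2 * 0.
  apply: cvgD; last by apply: cvgM; [exact: cvg_cst|exact: err_cvg].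
  apply: cvgM => //; apply: cvgD; apply: cvgM; try exact: cvg_cst.
    apply: cvgD; first by apply: cvgM; [exact: cvg_cst|exact: err_cvg].
    by apply: cvgM; [exact: cvg_cst|apply: cvgB; [exact: cvg_cst|exact: below_cvg]].
  apply: cvgM; first exact: cvg_cst.
  apply: cvgM; first exact: cvg_cst.
  by apply: cvgM => //; exact: cvg_cst.
move: H; rewrite !mulr0 add0r addr0 => H.
have G : (fun i => density R (h_ i) k (idx u i) - density R (h_ i) k (idx t i)
      - D i * box_rate d k B (fun c => density R (h_ i) c (idx w i))) @ U
    --> lim_density k u - lim_density k t - (u - t) * box_rate d k B (lim_density ^~ w).
  apply: cvgB; first by apply: cvgB; exact: lim_density_cvg.
  by apply: cvgM => //; exact: box_rate_cvg.
apply: (ler_cvg_to (cvg_norm G) H).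
near=> i; apply: (density_increment hvalid hdrift) => //.
- by rewrite !idx_le.
- exact: idx_size.
- by rewrite k0 /=; near: i; exact: near_U.
Unshelve. all: end_near. Qed.

(** A positive limit eventually exceeds the vanishing probability of a bad tuple, so [c] is
    realised. Hence [d] is bounded by [l * k] wherever the limit densities give it weight. *)
Lemma clip_support k t (c : 'I_l -> nat) : (0 < k)%N ->
  \prod_(j < l) lim_density (c j) t != 0 -> d k c = clip d k c.
Proof.
move=> k0 p0.
have pos : 0 < \prod_(j < l) lim_density (c j) t.
  by rewrite lt0r p0 prodr_ge0 // => j _; case/andP: (lim_density_itv (c j) t).
have G : (fun i => \prod_(j < l) density R (h_ i) (c j) (idx t i) - (l ^ 2)%:R * i.+1%:R^-1) @ U
    --> \prod_(j < l) lim_density (c j) t - (l ^ 2)%:R * 0.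
  apply: cvgB; first by apply: cvg_bigprod => j; exact: lim_density_cvg.
  by apply: cvgM; [exact: cvg_cst|exact: err_cvg].
move: G; rewrite mulr0 subr0 => /cvgr_gt /(_ 0 pos) /filter_ex[i]; rewrite subr_gt0.
exact: (clip_realised hvalid hdrift).
Qed.

Lemma lim_density0 k : lim_density k 0 = (k == 1%N)%:R.
Proof.
apply: cvg_lim => //.
have -> : (fun i => density R (h_ i) k (idx 0 i)) = fun=> (k == 1%N)%:R.
  apply/funext => i; rewrite /density /time_index mul0r truncn0 take0 Ncount_nil.
  by rewrite natrM mulrAC divff ?mul1r // gt_eqF.
exact: cvg_cst.
Qed.

End Limit.

(** * Conservation of mass *)

Lemma expR_le_1B (R : realType) (x : R) : 0 <= x <= 2^-1 -> expR (- (2 * x)) <= 1 - x.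
Proof.
move=> /andP[x0 x1]; rewrite expRN -[X in X <= _]mul1r ler_pdivrMr ?expR_gt0 //.
have := expR_ge1Dx (2 * x) => H.
have : (1 - x) * (1 + 2 * x) <= (1 - x) * expR (2 * x) by rewrite ler_wpM2l //; lra.
by apply: le_trans; nra.
Qed.

Section Survival.
Variables (R : realType) (y : R -> R) (a t u : R).
Hypotheses (a0 : 0 <= a) (tu : t <= u) (y_ge0 : forall v, 0 <= y v)
  (y_ge : forall v w, t <= v -> v <= w <= u ->
     y v - (w - v) * (a * (y v + (w - v) * a)) <= y w).

(** Euler steps for [y' >= - a * y]: each adds an error [(a * h) ^+ 2], and the contraction factor
    [1 - a * h] keeps the errors from growing. *)
Lemma euler_ge N m h : (0 < N)%N -> (m <= N)%N -> h = (u - t) / N%:R -> a * h <= 1 ->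
  y t * (1 - a * h) ^+ m - m%:R * (a * h) ^+ 2 <= y (t + m%:R * h).
Proof.
move=> N0 mN hE ah1.
have h0 : 0 <= h by rewrite hE divr_ge0 ?subr_ge0.
have ah0 : 0 <= a * h by rewrite mulr_ge0.
elim: m mN => [|m IH] mN; first by rewrite expr0 mul0r mulr1 subr0 mul0r addr0.
have mh : m.+1%:R * h <= u - t.
  by rewrite hE mulrCA ler_piMr ?subr_ge0 // ler_pdivrMr ?ltr0n // mul1r ler_nat.
have H : y (t + m%:R * h) - h * (a * (y (t + m%:R * h) + h * a)) <= y (t + m.+1%:R * h).
  have := @y_ge (t + m%:R * h) (t + m.+1%:R * h).
  rewrite (_ : t + m.+1%:R * h - (t + m%:R * h) = h); last by rewrite -natr1; ring.
  apply; first by rewrite lerDl mulr_ge0.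
  by rewrite lerD2l ler_wpM2r ?ler_nat //= -lerBrDl.
apply: le_trans H; have := IH (ltnW mN).
move: (y (t + m%:R * h)) => Y HY.
have c0 : 0 <= 1 - a * h by rewrite subr_ge0.
have := ler_wpM2r c0 HY; have m3 : 0 <= m%:R * (a * h) ^+ 3 by rewrite mulr_ge0 ?exprn_ge0.
rewrite -subr_ge0 => H1; rewrite -subr_ge0; apply: le_trans (addr_ge0 H1 m3) _.
by rewrite le_eqVlt; apply/orP; left; apply/eqP; rewrite [_ ^+ m.+1]exprSr -natr1; ring.
Qed.

(** Euler's scheme with ever finer steps. The factor 2 in the exponent comes from
    [1 - x >= expR (- (2 * x))], a lossy bound that suffices for a constant fraction. *)
Lemma survival : y t * expR (- (2 * (a * (u - t)))) <= y u.
Proof.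
apply/ler_addgt0Pr => e e0; set L := a * (u - t).
have L0 : 0 <= L by rewrite mulr_ge0 ?subr_ge0.
(* The first condition gives [a * h <= 1/2], the second keeps the accumulated Euler error
   [L ^+ 2 / N.+1] below [e]. *)
have [N [N1 N2]] : exists N : nat, 2 * L <= N.+1%:R /\ L ^+ 2 <= e * N.+1%:R.
  exists (Num.truncn (2 * L) + Num.truncn (L ^+ 2 / e))%N.
  rewrite -addnS natrD; split.
    apply: le_trans (ltW (truncnS_gt _)) _; rewrite -natr1 lerD2l.
    by rewrite ler1n.
  rewrite mulrC -ler_pdivrMr //; apply: le_trans (ltW (truncnS_gt _)) _.
  by rewrite lerDr.
set h := (u - t) / N.+1%:R.
have hN : N.+1%:R * h = u - t by rewrite /h mulrCA divff ?mulr1 // pnatr_eq0.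
have h0 : 0 <= h by rewrite divr_ge0 ?subr_ge0.
have ahL : N.+1%:R * (a * h) = L by rewrite mulrCA hN.
have ah0 : 0 <= a * h by rewrite mulr_ge0.
have ah2 : a * h <= 2^-1.
  by rewrite /h mulrA -/L ler_pdivrMr ?ltr0n //; move: N1; move: N.+1%:R => q; lra.
have ah1 : a * h <= 1 by lra.
have E : y t * (1 - a * h) ^+ N.+1 - N.+1%:R * (a * h) ^+ 2 <= y u.
  have -> : u = t + N.+1%:R * h by rewrite hN; ring.
  exact: (@euler_ge N.+1).
have E2 : N.+1%:R * (a * h) ^+ 2 <= e.
  have N0 : 0 < N.+1%:R :> R by rewrite ltr0n.
  rewrite -(ler_pM2r N0); apply: le_trans N2; rewrite -ahL le_eqVlt.
  by apply/orP; left; apply/eqP; ring.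
have E3 : expR (- (2 * L)) <= (1 - a * h) ^+ N.+1.
  rewrite -ahL (_ : - _ = (- (2 * (a * h))) * N.+1%:R); last by ring.
  rewrite expRM_natr; apply: lerXn2r; rewrite ?nnegrE ?expR_ge0 ?subr_ge0 //.
  by apply: expR_le_1B; rewrite ah0.
have := ler_wpM2l (y_ge0 t) E3; lra.
Qed.


End Survival.

Section NoMassEscapes.
Variables (R : realType) (l : nat) (ts : R) (rho chi : nat -> R -> R).
Local Notation M k t := (\sum_(1 <= j < k) rho j t).
Hypotheses (l0 : (0 < l)%N) (ts0 : 0 < ts) (rho_ge0 : forall k t, 0 <= rho k t)
  (M_le1 : forall k t, M k t <= 1)
  (M_lip : forall k t u, 0 <= t -> t <= u <= ts -> M k t <= M k u + (u - t) * (l * k)%:R)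
  (chi_decr : forall k t u, (0 < k)%N -> 0 <= t -> t <= u <= ts ->
     chi k u - chi k t <= (u - t) * - (1 - M k t) ^+ l)
  (chi_le : forall k b t, (0 < k)%N -> (0 < b)%N -> chi k t <= M b t / k%:R + b%:R^-1)
  (chi_ge : forall k a t, (0 < k)%N -> (a <= k)%N -> M a t / k%:R <= chi k t)
  (rho_ge : forall k t u, 0 <= t -> t <= u <= ts ->
     rho k t - (u - t) * ((l * k)%:R * (rho k t + (u - t) * (l * k)%:R)) <= rho k u).

Lemma partial_mass_mono t a b : (a <= b)%N -> M a t <= M b t.
Proof.
move=> ab; case: (leqP 1 a) => a1; last first.
  by rewrite big_geq ?(ltnW a1) //; apply: sumr_ge0.
by rewrite [X in _ <= X](big_cat_nat a1 ab) /= lerDl; apply: sumr_ge0.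
Qed.

Lemma partial_mass_cvg t : cvgn (fun k => M k t).
Proof.
apply: nondecreasing_is_cvgn; first by move=> a b; exact: partial_mass_mono.
by exists 1 => _ [k _ <-]; exact: M_le1.
Qed.

Lemma partial_mass_le_lim t k : M k t <= limn (fun k => M k t).
Proof.
apply: (@nondecreasing_cvgn_le _ (fun k => M k t)); last exact: partial_mass_cvg.
by move=> a b; exact: partial_mass_mono.
Qed.

Lemma partial_mass_cauchy (e : R) t : 0 < e -> exists K, forall a b, (K <= a)%N -> M b t - M a t < e.
Proof.
move=> e0; have := @partial_mass_cvg t.
move=> /cvgr_gt /(_ (limn (fun k => M k t) - e)); rewrite ltrBlDr ltrDl => /(_ e0) [K _ HK].
exists K => a b Ka; have := HK _ Ka; have := @partial_mass_le_lim t b => /=; lra.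
Qed.

(* Just before ts, during a time beta/k, the potential at scale k must drop by a
   constant times 1/k; this forces a constant mass in components of size between
   k/m and k*m, a constant fraction of which survives untouched up to ts. *)
Lemma mass_in_window (delta : R) : 0 < delta -> (forall k, delta <= 1 - M k ts) ->
  exists (m : nat) (e : R) (K : nat), 0 < e /\
    forall j, (K <= j)%N -> e <= M (m * (m * j)) ts - M j ts.
Proof.
move=> d0 tail; have lR : 0 < l%:R :> R by rewrite ltr0n.
(* During a time [beta / k] the mass below [k] changes by at most [beta * l = delta / 2], so
   [delta / 2] remains above [k] and the potential drops at rate at least [q]. *)
set beta := delta / (2 * l%:R); set q := (delta / 2) ^+ l.
have b0 : 0 < beta by rewrite divr_gt0 ?mulr_gt0.
have q0 : 0 < q by rewrite exprn_gt0 ?divr_gt0.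
have bq0 := mulr_gt0 b0 q0.
(* Two errors must each be at most [beta * q / 4]: [1 / m] from components larger than [b], and
   [beta * l / m] from the change of the mass below [j]. *)
pose m := (Num.truncn (4 * l%:R / q) + Num.truncn (4 / (beta * q))).+2.
have m0 : (0 < m)%N by [].
have mR : 0 < m%:R :> R by rewrite ltr0n.
have m1 : 4 * l%:R <= m%:R * q.
  rewrite -ler_pdivrMr //; apply: le_trans (ltW (truncnS_gt _)) _; rewrite ler_nat.
  by rewrite /m !ltnS leqW // leq_addr.
have m2 : 4 <= m%:R * (beta * q).
  rewrite -(ler_pdivrMr _ _ bq0); apply: le_trans (ltW (truncnS_gt _)) _; rewrite ler_nat.
  by rewrite /m !ltnS leqW // leq_addl.
(* Sizes in the window are below [b = m * k], so their loss rate times [beta / k] is at most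
   [l * m * beta]. *)
pose gam := expR (- (2 * (l%:R * m%:R * beta))).
(* The threshold on [j] ensures [beta / k <= ts], so that the interval starts at a nonnegative
   time. *)
exists m, (gam * (beta * q / 2)), (Num.truncn (beta / ts)).+1; split.
  by rewrite mulr_gt0 ?expR_gt0 // divr_gt0.
move=> j jK; have j0 : (0 < j)%N by exact: leq_trans jK.
have jR : 0 < j%:R :> R by rewrite ltr0n.
set k := (m * j)%N; set b := (m * k)%N.
have k0 : (0 < k)%N by rewrite muln_gt0 m0.
have kR : 0 < k%:R :> R by rewrite ltr0n.
have bb0 : (0 < b)%N by rewrite muln_gt0 m0.
have jk : (j <= k)%N by rewrite leq_pmull.
have kb : (k <= b)%N by rewrite leq_pmull.
set t := ts - beta / k%:R.
have bk0 : 0 <= beta / k%:R by rewrite divr_ge0 // ltW.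
have t0 : 0 <= t.
  rewrite subr_ge0 ler_pdivrMr // mulrC -ler_pdivrMr //.
  apply: le_trans (ltW (truncnS_gt _)) _; rewrite ler_nat; exact: leq_trans jK jk.
have tts : t <= ts <= ts by rewrite lexx andbT gerBl.
have tsB : ts - t = beta / k%:R by rewrite /t; ring.
have Mk : M k t <= 1 - delta / 2.
  have := M_lip k t0 tts; have := tail k.
  rewrite tsB (_ : beta / k%:R * (l * k)%:R = delta / 2); first lra.
  by rewrite natrM /beta; field; rewrite !gt_eqF.
have drop : chi k ts - chi k t <= - (beta / k%:R * q).
  apply: le_trans (chi_decr k0 t0 tts) _; rewrite tsB mulrN lerN2 ler_wpM2l //.
  by apply: lerXn2r; rewrite ?nnegrE; lra.
(* The lower bound uses [j = k / m] instead of [k]: mass below [j] barely moves in time [beta / k],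
   so its values at [t] and [ts] are interchangeable. *)
have up := chi_le t k0 bb0; have low := chi_ge ts k0 jk.
have Mj := M_lip j t0 tts.
have window : beta * q / 2 <= M b t - M j t.
  have : beta / k%:R * q <= M b t / k%:R + b%:R^-1 - M j ts / k%:R by lra.
  move=> H; have := ler_wpM2r (ltW kR) H.
  have -> : (M b t / k%:R + b%:R^-1 - M j ts / k%:R) * k%:R = M b t + m%:R^-1 - M j ts.
    by rewrite /b natrM; field; rewrite !gt_eqF.
  have -> : beta / k%:R * q * k%:R = beta * q by field; rewrite gt_eqF.
  have e1 : m%:R^-1 <= beta * q / 4.
    by rewrite -[X in X <= _]mul1r ler_pdivrMr //; lra.
  have e2 : (ts - t) * (l * j)%:R <= beta * q / 4.
    rewrite tsB /k !natrM.
    have -> : beta / (m%:R * j%:R) * (l%:R * j%:R) = beta * (l%:R / m%:R).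
      by field; rewrite !gt_eqF.
    rewrite -mulrA ler_pM2l // ler_pdivrMr //; lra.
  move: Mj e1 e2; move: ((ts - t) * _) (m%:R^-1) (M b t) (M j t) (M j ts) (beta * q) => *; lra.
have j1 : (1 <= j)%N by [].
have jb : (j <= b)%N by exact: leq_trans kb.
have split_M s : M b s - M j s = \sum_(j <= i < b) rho i s.
  by rewrite (big_cat_nat j1 jb) /= addrAC subrr add0r.
rewrite -/b split_M; move: window; rewrite split_M => window.
apply: le_trans (_ : gam * \sum_(j <= i < b) rho i t <= _).
  by rewrite ler_wpM2l ?expR_ge0.
rewrite mulr_sumr !big_nat; apply: ler_sum => i /andP[_ ib].
apply: le_trans (@survival R (rho i) (l * i)%:R t ts _ _ _ _) => //.
- rewrite mulrC ler_wpM2l // ler_expR lerN2 ler_pM2l // tsB.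
  rewrite natrM -mulrA -[X in _ <= X]mulrA ler_pM2l //.
  rewrite mulrCA [X in _ <= X]mulrC ler_pM2l // ler_pdivrMr // -natrM ler_nat.
  exact: ltnW.
- by case/andP: tts.
- move=> v w tv /andP[vw wt]; apply: rho_ge; first exact: le_trans tv.
  by rewrite vw.
Qed.

(** The partial masses at [ts] converge, so by the Cauchy property a single window far enough out
    already has mass below [e]. *)
Lemma mass_conserved : limn (fun k => M k ts) = 1.
Proof.
apply/eqP; rewrite eq_le; apply/andP; split.
  by apply: limr_le; [exact: partial_mass_cvg|exact: nearW].
rewrite leNgt; apply/negP => lt1.
have d0 : 0 < 1 - limn (fun k => M k ts) by rewrite subr_gt0.
have [k|m [e [K [e0 win]]]] := mass_in_window d0.
  by rewrite lerD2l lerN2 partial_mass_le_lim.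
have [K' cau] := @partial_mass_cauchy e ts e0.
have := win _ (leq_maxl K K'); have := cau _ (m * (m * maxn K K'))%N (leq_maxr K K').
lra.
Qed.

End NoMassEscapes.

(** * The limiting equations *)

Section Solution.
Variables (R : realType) (l : nat) (d : nat -> ('I_l -> nat) -> R) (ts : R) (rho : nat -> R -> R).
Local Notation M k t := (\sum_(1 <= j < k) rho j t).
Hypotheses (rho_itv : forall k t, 0 <= rho k t <= 1)
  (M_le1 : forall k t, M k t <= 1)
  (M_decr : forall k t u, t <= u -> M k u <= M k t)
  (M_lim : limn (fun k => M k ts) = 1)
  (clip_supp : forall k t (c : 'I_l -> nat), (0 < k)%N ->
     \prod_(j < l) rho (c j) t != 0 -> d k c = clip d k c)
  (incr : forall k B t w u, (0 < k)%N -> 0 <= t -> t <= w <= u -> u <= ts ->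
     `|rho k u - rho k t - (u - t) * box_rate d k B (rho ^~ w)| <=
     (u - t) * ((l * k)%:R * (l%:R * (1 - M B.+1 u))
        + (B ^ l)%:R * ((l * k)%:R * (l%:R * ((u - t) * (l * B)%:R)))))
  (rho_init : forall k, rho k 0 = (k == 1%N)%:R).

Let M_ge0 k t : 0 <= M k t.
Proof. by apply: sumr_ge0 => j _; case/andP: (rho_itv j t). Qed.

Let prod_ge0 (c : 'I_l -> nat) t : 0 <= \prod_(j < l) rho (c j) t.
Proof. by apply: prodr_ge0 => j _; case/andP: (rho_itv (c j) t). Qed.

Lemma box_rateE k B t : (0 < k)%N ->
  box_sum (fun c => d k c * \prod_(j < l) rho (c j) t) B = box_rate d k B (rho ^~ t).
Proof.
move=> k0; congr (box_sum _ B); apply/funext => c.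
have [->|/(clip_supp k0) -> //] := eqVneq (\prod_(j < l) rho (c j) t) 0.
by rewrite !mulr0.
Qed.

Lemma rate_abs_le k t c : (0 < k)%N ->
  `|d k c * \prod_(j < l) rho (c j) t| <= (l * k)%:R * \prod_(j < l) rho (c j) t.
Proof.
move=> k0; have [->|p0] := eqVneq (\prod_(j < l) rho (c j) t) 0.
  by rewrite !mulr0 normr0.
by rewrite (clip_supp k0 p0) normrM (ger0_norm (prod_ge0 _ _)) ler_wpM2r // clip_le.
Qed.

Lemma box_sumD B (F G : ('I_l -> nat) -> R) :
  box_sum (fun c => F c + G c) B = box_sum F B + box_sum G B.
Proof. exact: big_split. Qed.

Lemma box_sumZ B a (F : ('I_l -> nat) -> R) : box_sum (fun c => a * F c) B = a * box_sum F B.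
Proof. by rewrite /box_sum mulr_sumr. Qed.

Lemma box_sum_le B (F G : ('I_l -> nat) -> R) :
  (forall c, F c <= G c) -> box_sum F B <= box_sum G B.
Proof. by move=> FG; apply: ler_sum. Qed.

Lemma box_sum_rho_le B t a : 0 <= a ->
  box_sum (fun c => a * \prod_(j < l) rho (c j) t) B <= a.
Proof.
move=> a0; rewrite box_sumZ (box_sum_prod _ _ (rho ^~ t)) ler_piMr //.
by apply: exprn_ile1.
Qed.

(** [G] dominates the absolute value of [F], so [G + F] and [G - F] have monotone box sums and the
    increment of [F] is at most that of [G]. The latter is at most [l * k] times [1 - M ^+ l]. *)
Lemma box_rate_tail k B N t : (0 < k)%N -> (B <= N)%N ->
  `|box_rate d k N (rho ^~ t) - box_rate d k B (rho ^~ t)| <=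
    (l * k)%:R * (l%:R * (1 - M B.+1 t)).
Proof.
move=> k0 BN.
pose F c := d k c * \prod_(j < l) rho (c j) t.
pose G (c : 'I_l -> nat) := (l * k)%:R * \prod_(j < l) rho (c j) t.
have FG c : - G c <= F c <= G c by rewrite -ler_norml rate_abs_le.
have lo : box_sum (fun c => G c + F c) B <= box_sum (fun c => G c + F c) N.
  by apply: box_sum_mono => // c; have /andP[] := FG c; lra.
have hi : box_sum (fun c => G c + -1 * F c) B <= box_sum (fun c => G c + -1 * F c) N.
  by apply: box_sum_mono => // c; have /andP[] := FG c; lra.
have GN : box_sum G N <= (l * k)%:R by exact: box_sum_rho_le.
have GB : (l * k)%:R - (l * k)%:R * (l%:R * (1 - M B.+1 t)) <= box_sum G B.
  rewrite /G box_sumZ (box_sum_prod _ _ (rho ^~ t)) -{1}[(l * k)%:R]mulr1 -mulrBr ler_wpM2l //.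
  have : `|1 - M B.+1 t ^+ l| <= l%:R * (1 - M B.+1 t).
    have := @prod_lip R _ (index_enum 'I_l) (fun=> 1) (fun=> M B.+1 t).
    rewrite !prodr_const sumr_const card_ord expr1n mulr_natl (@ger0_norm _ (1 - M B.+1 t)) ?subr_ge0 //.
    by move=> H; apply: H => _; rewrite ?ler01 ?lexx ?M_ge0 ?M_le1.
  rewrite ler_norml => /andP[_].
  by move: (l%:R * _) (_ ^+ l) => *; lra.
rewrite !box_sumD in lo; rewrite !box_sumD (box_sumZ N (-1) F) (box_sumZ B (-1) F) in hi.
rewrite -!box_rateE // -/F; move: lo hi GN GB.
move: (box_sum G N) (box_sum G B) (box_sum F N) (box_sum F B) => gN gB fN fB.
move: ((l * k)%:R * (l%:R * (1 - M B.+1 t))) (l * k)%:R => x y *.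
by rewrite ler_norml; apply/andP; split; lra.
Qed.

(** The summand is a difference of two nonnegative families, [F + G] and [G], with bounded box
    sums. *)
Lemma rate_cvg k t : (0 < k)%N -> cvgn (fun B => box_rate d k B (rho ^~ t)).
Proof.
move=> k0.
pose F c := d k c * \prod_(j < l) rho (c j) t.
pose G (c : 'I_l -> nat) := (l * k)%:R * \prod_(j < l) rho (c j) t.
have FG c : - G c <= F c <= G c by rewrite -ler_norml rate_abs_le.
have -> : (fun B => box_rate d k B (rho ^~ t)) =
    (fun B => box_sum (fun c => F c + G c) B) - box_sum G.
  by apply/funext => B; rewrite -box_rateE // fctE box_sumD addrK.
have Gle B : box_sum G B <= (l * k)%:R by exact: box_sum_rho_le.
apply: is_cvgB; apply: nondecreasing_is_cvgn.
- by move=> a b ab; apply: box_sum_mono => // c; have /andP[] := FG c; lra.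
- exists ((l * k)%:R + (l * k)%:R) => _ [B _ <-]; rewrite box_sumD lerD //.
  by apply: le_trans (Gle B); apply: box_sum_le => c; have /andP[] := FG c.
- by move=> a b ab; apply: box_sum_mono => // c; rewrite /G mulr_ge0.
- by exists (l * k)%:R => _ [B _ <-].
Qed.

(** [incr] is applied with [w = t] as right or left endpoint, according to the sign of [u - t].
    Tails grow with time, so the one at [ts] bounds them all. *)
Lemma difference_quotient k B t u : (0 < k)%N -> 0 <= t <= ts -> 0 <= u <= ts -> u != t ->
  `|(rho k u - rho k t) / (u - t) - box_rate d k B (rho ^~ t)| <=
    (l * k)%:R * (l%:R * (1 - M B.+1 ts))
    + (B ^ l)%:R * ((l * k)%:R * (l%:R * (`|u - t| * (l * B)%:R))).
Proof.
move=> k0 /andP[t0 tts] /andP[u0 uts] ut.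
have ut0 : 0 < `|u - t| by rewrite normr_gt0 subr_eq0.
rewrite -(ler_pM2l ut0) -normrM mulrBr mulrCA divff ?subr_eq0 // mulr1.
have tail v : v <= ts -> (l * k)%:R * (l%:R * (1 - M B.+1 v)) <= (l * k)%:R * (l%:R * (1 - M B.+1 ts)).
  by move=> vts; rewrite !ler_wpM2l // lerD2l lerN2 M_decr.
case: (ltgtP u t) ut => // [ut|tu] _.
  have := incr B k0 u0 (_ : u <= t <= t) tts; rewrite (ltW ut) lexx => /(_ isT).
  rewrite (ltr0_norm (_ : u - t < 0)) ?subr_lt0 // (opprB u t) => H; rewrite -normrN.
  rewrite [X in `|X|](_ : _ = rho k t - rho k u - (t - u) * box_rate d k B (rho^~ t)); last by ring.
  by apply: le_trans H _; rewrite ler_wpM2l ?subr_ge0 ?(ltW ut) // lerD2r tail.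
have := incr B k0 t0 (_ : t <= t <= u) uts; rewrite (ltW tu) lexx => /(_ isT).
rewrite (gtr0_norm (_ : 0 < u - t)) ?subr_gt0 // => H.
by apply: le_trans H _; rewrite ler_wpM2l ?subr_ge0 ?(ltW tu) // lerD2r tail.
Qed.

Lemma limit_is_solution : is_solution d ts rho.
Proof.
split => [t _ k _|t _ N|k k0 t t_itv||k k1].
- exact: rho_itv.
- by rewrite M_ge0 M_le1.
- have c := @rate_cvg k t k0; set s := limn (fun B => box_rate d k B (rho ^~ t)) in c.
  exists s.
    split.
      exists (l * k)%:R => N; apply: le_trans (box_sum_rho_le N t (ler0n _ _)).
      by apply: box_sum_le => x; exact: rate_abs_le.
    by under eq_fun do rewrite box_rateE //.
  have s_close B : `|s - box_rate d k B (rho ^~ t)| <= (l * k)%:R * (l%:R * (1 - M B.+1 t)).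
    have : (fun N => `|box_rate d k N (rho ^~ t) - box_rate d k B (rho ^~ t)|) @ \oo
        --> `|s - box_rate d k B (rho ^~ t)|.
      by apply: cvg_norm; apply: cvgB => //; exact: cvg_cst.
    move=> /cvgr_to_le; apply; near=> N; apply: box_rate_tail => //.
    by near: N; exact: nbhs_infty_ge.
  apply/cvgrPdist_le => e e0; rewrite near_withinE.
  (* Conservation of mass at [ts] enters here: one cutoff [B] makes every truncation error on [0,
     [ts]] small. The added 1 avoids a zero denominator. *)
  have [B tailB] : exists B, (l * k)%:R * (l%:R * (1 - M B.+1 ts)) <= e / 4.
    have a0 : 0 < (l * k)%:R * l%:R + 1 :> R by rewrite ltr_wpDl // mulr_ge0.
    have Mc : cvgn (fun k => M k ts).
      by apply: partial_mass_cvg => // j v; case/andP: (rho_itv j v).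
    have := Mc => /cvgr_gt /(_ (1 - e / 4 / ((l * k)%:R * l%:R + 1))).
    rewrite M_lim gtrBl !divr_gt0 // => /(_ isT)[B _ HB].
    exists B; have := HB B.+1 (leqnSn B) => /= {}HB.
    have {}HB : 1 - M B.+1 ts <= e / 4 / ((l * k)%:R * l%:R + 1) by lra.
    have M1 : 0 <= 1 - M B.+1 ts by rewrite subr_ge0.
    move: HB; rewrite ler_pdivlMr // mulrDr mulr1 => H.
    by apply: le_trans H; rewrite mulrA mulrC lerDl.
  pose C : R := (B ^ l)%:R * ((l * k)%:R * (l%:R * (l * B)%:R)).
  have C0 : 0 <= C by rewrite !mulr_ge0.
  have C1 : 0 < C + 1 by lra.
  (* With [B] fixed, the remaining error is [C * |u - t|]; this radius keeps it below [e / 2], next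
     to two tails of [e / 4]. *)
  apply/nbhs_ballP; exists (e / 2 / (C + 1)) => /=; first by rewrite !divr_gt0.
  move=> u; rewrite /ball /= => ut [u_itv une].
  have close := difference_quotient B k0 t_itv u_itv une.
  have Cu : (B ^ l)%:R * ((l * k)%:R * (l%:R * (`|u - t| * (l * B)%:R))) <= e / 2.
    have -> : (B ^ l)%:R * ((l * k)%:R * (l%:R * (`|u - t| * (l * B)%:R))) = C * `|u - t|.
      by rewrite /C; ring.
    move: ut; rewrite distrC ltr_pdivlMr // => ut.
    by apply: le_trans (ltW ut); rewrite mulrC ler_wpM2l // lerDl.
  have tB : (l * k)%:R * (l%:R * (1 - M B.+1 t)) <= e / 4.
    apply: le_trans tailB; rewrite !ler_wpM2l // lerD2l lerN2 M_decr //.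
    by case/andP: t_itv.
  have := s_close B; move: close; rewrite [`|_ / _ - _|]distrC => close close'.
  rewrite [X in `|X|](_ : _ = (s - box_rate d k B (rho ^~ t)) +
     (box_rate d k B (rho ^~ t) - (rho k u - rho k t) / (u - t))); last by ring.
  apply: le_trans (ler_normD _ _) _.
  apply: le_trans (lerD (le_trans close' tB) (le_trans close (lerD tailB Cu))) _.
  by rewrite le_eqVlt; apply/orP; left; apply/eqP; field.
- by rewrite rho_init.
- by rewrite rho_init gtn_eqF.
Unshelve. all: end_near. Qed.

End Solution.

(** * Contradiction with the assumed loss of mass *)

Theorem theorem8 (R : realType) (l : nat) (hl : (2 <= l)%N) (r : rule R l)
  (hvalid : valid_rule r) (hmerge : merging r)
  (d : nat -> ('I_l -> nat) -> R) (hdrift : drift r d)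
  (ts : R) (hts : 0 <= ts)
  (hsol : forall rho : nat -> R -> R, is_solution d ts rho ->
            limn (fun N => \sum_(1 <= k < N) rho k ts) < 1) :
  forall t : R, ts <= t -> forall eps : R, 0 < eps ->
  exists alpha : R, 0 < alpha /\
  exists n0 : nat, (0 < n0)%N /\
  forall n : nat, (n0 <= n)%N ->
    1 - eps <= prob r n (Num.truncn (t * n%:R))
                 (fun h => alpha * n%:R <= (L1 h)%:R).
Proof.
move=> T tsT eps eps0; apply: contrapT => none.
have T0 : 0 <= T by exact: le_trans tsT.
have neg (alpha : R) : 0 < alpha -> forall n0, (0 < n0)%N -> exists2 n, (n0 <= n)%N &
    prob r n (Num.truncn (T * n%:R)) (fun h => alpha * n%:R <= (L1 h)%:R) < 1 - eps.
  move=> a0 n0 n00; apply: contrapT => H; apply: none; exists alpha; split => //.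
  exists n0; split => // n nn0; rewrite leNgt; apply/negP => lt; apply: H.
  by exists n.
have [H HP] := @choice _ _ (fun i (q : {n : nat & seq (step n l)}) =>
    [/\ (i < projT1 q)%N, size (projT2 q) = Num.truncn (T * (projT1 q)%:R)
      & typical r i (projT2 q)])
  (fun i => let: ex_intro n (ex_intro h Hh) := typical_exists hvalid T0 eps0 neg i in
    ex_intro _ (existT _ n h) Hh).
pose h_ i := projT2 (H i).
have i_lt_n i : (i < projT1 (H i))%N by case: (HP i).
have size_h i : size (h_ i) = Num.truncn (T * (projT1 (H i))%:R) by case: (HP i).
have typ i : typical r i (h_ i) by case: (HP i).
(* [U] refines convergence to infinity, so the errors [1 / i.+1] vanish along it. *)
have [U [UU U_oo]] := ultraFilterLemma eventually_filter.
pose rho := lim_density (R := R) h_ U; pose chi := lim_pot (R := R) h_ U.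
have range (t u : R) : t <= u <= ts -> t <= u <= T.
  by move=> /andP[-> /le_trans]; apply.
have rho_itv k t : 0 <= rho k t <= 1 by exact: lim_density_itv.
have rho0 k : rho k 0 = (k == 1%N)%:R by exact: lim_density0.
have lim1 : limn (fun k => \sum_(1 <= j < k) rho j ts) = 1.
  have M_le1 k t : \sum_(1 <= j < k) rho j t <= 1 by exact: mass_below_le1.
  have rho_ge0 k t : 0 <= rho k t by case/andP: (rho_itv k t).
  (* The window argument needs time before [ts]; at [ts = 0] all mass sits at size 1. *)
  move: hts; rewrite le_eqVlt => /orP[/eqP <-|ts0].
    apply: cvg_lim => //; apply: cvg_near_cst; exists 2 => // k /= k2.
    rewrite big_ltn // rho0 // eqxx big_nat big1 ?addr0 // => j /andP[j2 _].
    by rewrite rho0 // gtn_eqF.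
  apply: (@mass_conserved R l ts rho chi) => //.
  - exact: leq_trans hl.
  - by move=> k t u t0 /range; exact: mass_below_lip.
  - by move=> k t u k0 t0 /range; exact: lim_pot_decrease.
  - by move=> k b t; exact: lim_pot_le.
  - by move=> k a t; exact: lim_pot_ge.
  - by move=> k t u t0 /range; exact: lim_density_ge.
have sol : is_solution d ts rho.
  apply: limit_is_solution => //.
  - exact: mass_below_le1.
  - by move=> k t u; exact: mass_below_decr.
  - by move=> k t c; exact: clip_support.
  - move=> k B t w u k0 t0 twu uts; apply: lim_density_increment => //.
    exact: le_trans tsT.
by have := hsol _ sol; rewrite lim1 ltxx.
Qed.
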